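(* There exist $L_0=L_0(n)>0$ small enough and $C=C(n)>0$ such that the following holds. Let $\Omega=\mathbb{R}^n\setminus\mathcal{S}\subset\mathbb{R}^n$ be a Lipschitz slit domain with Lipschitz constant $L\le L_0$. Then there exist $\zeta_1,\zeta_2\in C^{1,1}_{\mathrm{loc}}(\Omega)$ such that $$\Phi(y):=\big(y'',\zeta_1(y),\zeta_2(y)\big)$$ maps $\Omega=\mathbb{R}^n\setminus\mathcal{S}$ into $\mathbb{R}^n\setminus\mathcal{H}$, and the following estimates hold for every $y\in\Omega$: $$|\zeta_1(y)-(y_{n-1}-\gamma(y''))|+|\zeta_2(y)-(y_n-\Gamma(y'))|\le CL\,\mathrm{dist}(y,\mathcal{S}),$$ $$|\nabla\zeta_1(y)-e_{n-1}|+|\nabla\zeta_2(y)-e_n|\le CL,$$ and, for a.e. $y\in\Omega$, $$|D^2\zeta_1(y)|+|D^2\zeta_2(y)|\le C\,\frac{L}{\mathrm{dist}(y,\mathcal{S})}.$$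
   Context: Here $n\ge2$, and points are written $y=(y'',y_{n-1},y_n)\in\mathbb{R}^{n-2}\times\mathbb{R}\times\mathbb{R}$, $y'=(y'',y_{n-1})\in\mathbb{R}^{n-1}$; $e_1,\dots,e_n$ is the canonical basis. Given Lipschitz functions $\gamma:\mathbb{R}^{n-2}\to\mathbb{R}$ and $\Gamma:\mathbb{R}^{n-1}\to\mathbb{R}$ with $\|\nabla\gamma\|_{L^\infty}\le L$, $\|\nabla\Gamma\|_{L^\infty}\le L$, normalized by $\gamma(0)=\Gamma(0)=0$ (standing assumption; if $n=2$, $\gamma$ is the constant $0$), the associated slit is $\mathcal{S}=\{x\in\mathbb{R}^n:x_{n-1}\le\gamma(x''),\ x_n=\Gamma(x')\}$, and $\Omega=\mathbb{R}^n\setminus\mathcal{S}$ is called a Lipschitz slit domain with Lipschitz constant $L$. The model slit is $\mathcal{H}=\{x\in\mathbb{R}^n:x_{n-1}\le0,\ x_n=0\}$. *)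

(* Defs.v *)
From HB Require Import structures.
From mathcomp Require Import all_boot all_order all_algebra.
From mathcomp Require Import all_classical all_reals all_analysis.

Set Implicit Arguments.
Unset Strict Implicit.
Unset Printing Implicit Defensive.

Import Order.TTheory GRing.Theory Num.Theory.
Import numFieldNormedType.Exports.

Local Open Scope classical_set_scope.
Local Open Scope ring_scope.

Section Euclidean.
Context {R : realType}.

(* The library norm `|.| on matrices is the sup norm. *)
Definition enorm (p q : nat) (A : 'M[R]_(p, q)) : R :=
  Num.sqrt (\sum_i \sum_j A i j ^+ 2).

Definition dist (n : nat) (y : 'rV[R]_n) (A : set 'rV[R]_n) : R :=
  inf [set enorm (y - s) | s in A].

Definition box (n : nat) (a b : 'rV[R]_n) : set 'rV[R]_n :=
  [set x | forall i, a 0 i <= x 0 i <= b 0 i].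

(* Lebesgue-null sets, by countable covers with boxes of small total volume.
   The covers are indexed by subsets D of nat, so that set0 is also null in
   dimension 0, where every box is a point of volume 1. *)
Definition lebesgue_null (n : nat) (A : set 'rV[R]_n) : Prop :=
  forall eps : R, 0 < eps ->
  exists (D : set nat) (a b : nat -> 'rV[R]_n),
    [/\ forall k i, a k 0 i <= b k 0 i,
        A `<=` \bigcup_(k in D) box (a k) (b k) &
        (\esum_(k in D) (\prod_i (b k 0 i - a k 0 i))%:E <= eps%:E)%E].

Definition ae_in (n : nat) (D : set 'rV[R]_n) (P : 'rV[R]_n -> Prop) : Prop :=
  lebesgue_null [set x | D x /\ ~ P x].

Definition grad (n : nat) (f : 'rV[R]_n -> R) (x : 'rV[R]_n) : 'rV[R]_n :=
  \row_i 'D_(delta_mx 0 i) f x.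

Definition hess (n : nat) (f : 'rV[R]_n -> R) (x : 'rV[R]_n) : 'M[R]_n :=
  'J (grad f) x.

(* The differentiability clause holds almost everywhere by Rademacher; it
   discards the junk value of grad elsewhere. The clause lipschitz f only asks
   for some Lipschitz constant, so the choice of norm in it is immaterial. *)
Definition lipschitz_grad_le (n : nat) (f : 'rV[R]_n -> R) (L : R) : Prop :=
  lipschitz f /\
  ae_in setT (fun x => differentiable f x /\ enorm (grad f x) <= L).

Definition C11_loc (n : nat) (U : set 'rV[R]_n) (f : 'rV[R]_n -> R) : Prop :=
  (forall x, U x -> differentiable f x) /\
  (forall K : set 'rV[R]_n, compact K -> K `<=` U ->
     [lipschitz grad f x | x in K]).

End Euclidean.

(* Coordinates y = (y'', y_(n-1), y_n) of R^n, with n = m.+2. *)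
Section SlitDomains.
Context {R : realType} {m : nat}.
Implicit Types (y : 'rV[R]_m.+2) (gamma : 'rV[R]_m -> R)
  (Gamma : 'rV[R]_m.+1 -> R).

Definition idx_n : 'I_m.+2 := ord_max.
Definition idx_n1 : 'I_m.+2 := lift ord_max ord_max.

Definition pr1 y : 'rV[R]_m.+1 := col' ord_max y.
Definition pr2 y : 'rV[R]_m := col' ord_max (pr1 y).

Definition snoc (k : nat) (v : 'rV[R]_k) (t : R) : 'rV[R]_k.+1 :=
  \row_i oapp (v 0) t (unlift ord_max i).

Definition slit gamma Gamma : set 'rV[R]_m.+2 :=
  [set x : 'rV[R]_m.+2 | x 0 idx_n1 <= gamma (pr2 x) /\ x 0 idx_n = Gamma (pr1 x)].

Definition model_slit : set 'rV[R]_m.+2 :=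
  [set x : 'rV[R]_m.+2 | x 0 idx_n1 <= 0 /\ x 0 idx_n = 0].

(* For m = 0 the condition gamma 0 = 0 forces gamma to be the constant 0. *)
Definition slit_data gamma Gamma (L : R) : Prop :=
  [/\ lipschitz_grad_le gamma L, lipschitz_grad_le Gamma L,
      gamma 0 = 0 & Gamma 0 = 0].

End SlitDomains.

(* Main.v *)
Require Import Defs.
From HB Require Import structures.
From mathcomp Require Import all_boot all_order all_algebra.
From mathcomp Require Import all_classical all_reals all_analysis.
From mathcomp Require Import measurable_realfun ring lra zify.

(* An a.e. gradient bound makes gamma and Gamma globally Lipschitz. This is seen
   on lines parallel to the axes: covers of the exceptional set by boxes of small
   volume meet most of these lines in small length, and on such a line the 1-D
   estimate follows from a continuity argument.

   A Lipschitz function g on R^n is then smoothed at a scale comparable to the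
   distance delta to the slit: the dyadic lattice points p = 2^j k with
   delta p comparable to 2^j carry bumps w_p of radius n 2^j, and
   g~ = (sum_p w_p g(p)) / (sum_p w_p) is of class C^2 off the slit. Subtracting
   the constant g(y) before differentiating at y gives
   |g~ - g| <= C L delta, |D g~| <= C L and |D^2 g~| <= C L / delta.
   With zeta1 = y_(n-1) - gamma~ and zeta2 = y_n - Gamma~, a point y with Phi(y)
   in the model slit would lie within C L delta(y) of the slit, which is
   impossible for small L. *)

Set Implicit Arguments.
Unset Strict Implicit.
Unset Printing Implicit Defensive.

Import Order.TTheory GRing.Theory Num.Theory.
Import numFieldNormedType.Exports.

Local Open Scope classical_set_scope.
Local Open Scope ring_scope.

(** * Lipschitz bounds from almost everywhere bounds *)

(** Integrate over [[q1, q2]] the sum of the [c k] whose interval contains the point, and exchange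
    sum and integral: interval [k] contributes at most [c k * (b k - a k)]. *)
Lemma interval_cover_weight (R : realType) (D : set nat) (c a b : nat -> R)
    (q1 q2 lam : R) :
  (forall k, 0 <= c k) -> (forall k, a k <= b k) -> q1 <= q2 -> 0 <= lam ->
  (forall t, q1 <= t <= q2 ->
    (lam%:E <= \esum_(k in D `&` [set k | a k <= t <= b k]%R) (c k)%:E)%E) ->
  ((lam * (q2 - q1))%:E <= \esum_(k in D) (c k * (b k - a k))%:E)%E.
Proof.
move=> c0 ab q12 lam0 H.
pose f k t : \bar R := ((if k \in D then c k else 0)%:E * (\1_(`[a k, b k]%classic) t)%:E)%E.
have f0 k t : (0 <= f k t)%E.
  by rewrite /f -EFinM lee_fin mulr_ge0//; case: ifP.
have mf k : measurable_fun `[q1, q2] (f k).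
  apply: measurable_funeM; apply/measurable_EFinP.
  exact: measurable_indic.
pose mu := @lebesgue_measure R.
have muI u v : u <= v -> mu `[u, v]%classic = (v - u)%:E.
  move=> uv; rewrite /mu lebesgue_measure_itv/= lte_fin -EFinB.
  by case: ltgtP uv => // -> _; rewrite subrr.
have -> : (lam * (q2 - q1))%:E = (\int[mu]_(x in `[q1, q2]) (cst lam%:E) x)%E.
  by rewrite (integral_cst mu)// EFinM; congr (_ * _)%E; rewrite -(muI _ _ q12).
apply: (@le_trans _ _ (\int[mu]_(x in `[q1, q2]) (\sum_(k <oo) f k x))%E).
  apply: ge0_le_integral => //.
  - apply: (@ge0_emeasurable_sum _ _ R _ f xpredT) => [k x _ _|k _]; [exact: f0 | exact: mf].
  - move=> t; rewrite /= in_itv/= => /H/le_trans; apply.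
    rewrite nneseries_esumT// esum_mkcond; apply: le_esum => k _.
    rewrite in_setI /f indicE; case: (k \in D) => /=; last by rewrite mul0e.
    case: ifP => [|_]; last by rewrite -EFinM lee_fin mulr_ge0.
    by rewrite inE/= => h; rewrite mem_set ?mule1//= in_itv.
rewrite integral_nneseries//.
rewrite (esum_mkcond D) nneseries_esumT; last by move=> k; apply: integral_ge0.
apply: le_esum => k _.
rewrite ge0_integralZl//; last 2 first.
  by apply/measurable_EFinP; exact: measurable_indic.
  by rewrite lee_fin; case: ifP.
rewrite integral_indic//.
case: ifP => _; last by rewrite mul0e.
rewrite EFinM lee_wpmul2l ?lee_fin//.
rewrite -muI//; apply: le_measure => //; rewrite inE//.
exact: measurableI.
Qed.

(** Induction on the coordinates by slicing: the induction hypothesis treats the boxes that meet a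
    slice, and [interval_cover_weight] integrates over the slices. The contrapositive finds a line
    that meets the boxes in small length; the list [s] leaves out the direction of that line. *)
Lemma box_cover_weight (R : realType) (I : eqType) (s : seq I) (D : set nat)
    (c : nat -> R) (a b : nat -> I -> R) (q1 q2 : I -> R) (lam : R) :
  uniq s -> (forall k, 0 <= c k) -> (forall k i, a k i <= b k i) ->
  (forall i, q1 i <= q2 i) -> 0 <= lam ->
  (forall x : I -> R, {in s, forall i, q1 i <= x i <= q2 i} ->
    (lam%:E <= \esum_(k in D `&` [set k | {in s, forall i, (a k i <= x i <= b k i)%R}])
      (c k)%:E)%E) ->
  ((lam * \prod_(i <- s) (q2 i - q1 i))%:E <=
    \esum_(k in D) (c k * \prod_(i <- s) (b k i - a k i))%:E)%E.
Proof.
move=> us c0 ab q12 lam0; elim: s D lam lam0 us => [|i s IH] D lam lam0 /=.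
  move=> _ /(_ q1) H; rewrite big_nil mulr1; apply: (le_trans (H _)) => //.
  rewrite [X in esum X _](_ : _ = D).
    by apply: le_esum => k _; rewrite big_nil mulr1.
  by apply/seteqP; split => [k []//|k Dk]; split.
move=> /andP[si us] H.
have prod_ge0 (u v : I -> R) : (forall j, u j <= v j) -> 0 <= \prod_(j <- s) (v j - u j).
  by move=> uv; rewrite big_seq prodr_ge0// => j _; rewrite subr_ge0.
rewrite big_cons [X in (lam * X)%R]mulrC mulrA.
rewrite (eq_esum (b := fun k => ((c k * \prod_(j <- s) (b k j - a k j)) * (b k i - a k i))%:E)).
  apply: interval_cover_weight => //.
  - by move=> k; rewrite mulr_ge0// prod_ge0.
  - by rewrite mulr_ge0// prod_ge0.
  - move=> t qt; apply: IH => // x sx.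
    pose y j := if j == i then t else x j.
    have ys j : j \in s -> y j = x j.
      by rewrite /y; case: eqP => // -> /idP; rewrite (negbTE si).
    apply: (le_trans (H y _)).
      move=> j; rewrite inE => /orP[/eqP ->|js]; first by rewrite /y eqxx.
      by rewrite ys//; exact: sx.
    rewrite le_eqVlt; apply/orP; left; apply/eqP; congr esum.
    apply/seteqP; split => k /=.
      move=> [Dk yk]; split; first split => //.
        by have := yk i (mem_head _ _); rewrite /y eqxx.
      by move=> j js; rewrite -ys//; apply: yk; rewrite inE js orbT.
    move=> [[Dk tk] xk]; split => // j; rewrite inE => /orP[/eqP ->|js].
      by rewrite /y eqxx.
    by rewrite ys//; exact: xk.
by move=> k _; rewrite big_cons [X in (c k * X)%R]mulrC mulrA.
Qed.

(** Outer regularity gives an open [U] around the intervals of measure at most [lam + e], and [W x]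
    measures the part of [U] to the left of [x]. Openness makes [W] grow at unit speed just to the
    right of each covered point. *)
Lemma length_function (R : realType) (D : set nat) (al be : nat -> R) (lam e : R) :
  (forall k, al k <= be k) -> 0 < e ->
  (\esum_(k in D) (be k - al k)%:E <= lam%:E)%E ->
  exists W : R -> R,
  [/\ {homo W : x y / x <= y}, forall x, 0 <= W x <= lam + e &
      forall k t, D k -> al k <= t <= be k ->
        exists2 r : R, 0 < r & forall s, t <= s < t + r -> W t + (s - t) <= W s].
Proof.
move=> ab e0 Hlam.
pose mu : {measure set (measurableTypeR R) -> \bar R} := @lebesgue_measure R.
pose F k : set R := if k \in D then `[al k, be k]%classic else set0.
have mF k : measurable (F k) by rewrite /F; case: ifP.
have mV : measurable (\bigcup_k F k) by exact: bigcup_measurable.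
have muV : (mu (\bigcup_k F k) <= lam%:E)%E.
  apply: (@le_trans _ _ (\sum_(k <oo) mu (F k))%E).
    exact: generalized_Boole_inequality.
  apply: le_trans Hlam; rewrite nneseries_esumT// (esum_mkcond D).
  apply: le_esum => k _; rewrite /F; case: ifP => _; last by rewrite measure0.
  rewrite /mu /= lebesgue_measure_itv/= lte_fin -EFinB.
  by case: ltgtP (ab k) => // -> _; rewrite subrr.
have [U [oU VU muUV]] := lebesgue_regularity_outer mV (le_lt_trans muV (ltry _)) e0.
have mU : measurable U by exact: open_measurable.
have muU : (mu U <= (lam + e)%:E)%E.
  rewrite (measureDI mu mU mV) addeC EFinD leeD//; last exact: ltW.
  by rewrite setIidr.
pose A (c : R) : set R := U `&` `]-oo, c]%classic.
have mA c : measurable (A c) by apply: measurableI.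
have muA c : (mu (A c) <= (lam + e)%:E)%E.
  apply: le_trans muU; apply: (le_measure mu (mem_set (mA c)) (mem_set mU)).
  exact: subIsetl.
have fA c : mu (A c) \is a fin_num.
  by rewrite ge0_fin_numE// (le_lt_trans (muA c))// ltry.
exists (fun c => fine (mu (A c))); split.
- move=> x y xy; apply: fine_le => //; apply: (le_measure mu (mem_set (mA x)) (mem_set (mA y))).
  by apply: setIS => z /=; rewrite !in_itv/= => /le_trans; apply.
- by move=> x; apply/andP; split; [exact: fine_ge0 | rewrite -lee_fin (fineK (fA x))].
- move=> k t Dk tk.
  have Ut : U t by apply: VU; exists k => //; rewrite /F mem_set//= in_itv.
  have /nbhs_ballP[r /= r0 rU] : nbhs t U by apply: oU.
  exists r => // s /andP[ts sr].
  have : (mu (A t) + mu `]t, s]%classic <= mu (A s))%E.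
    have mI : measurable (`]t, s]%classic : set R) by [].
    rewrite -(measureU mu (mA t) mI).
      have mAt : measurable (A t `|` `]t, s]%classic) by exact: measurableU.
      apply: (le_measure mu (mem_set mAt) (mem_set (mA s))).
      move=> z [[Uz /=]|/=]; rewrite !in_itv/=.
        by move=> zt; split => //=; rewrite in_itv/= (le_trans zt).
      move=> /andP[tz zs]; split; last by rewrite /= in_itv.
      by apply: rU; rewrite /ball/= ltr_distlC; apply/andP; split; lra.
    apply/seteqP; split => z //= [[_ /=]]; rewrite !in_itv/= => zt /andP[].
    by rewrite ltNge zt.
  rewrite -(fineK (fA t)) -(fineK (fA s)).
  rewrite {2}/mu /= lebesgue_measure_itv/= lte_fin -EFinB.
  move: ts; rewrite le_eqVlt => /orP[/eqP <-|->]; last by rewrite -EFinD lee_fin.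
  by move=> _; rewrite subrr addr0.
Qed.

(** Continuous induction on [c] for the bound [bnd c] below. At a covered point the growth of [W]
    pays for the Lipschitz constant; elsewhere the derivative bound advances [c], and the margin [e]
    absorbs the error. *)
Lemma growth_bound (R : realType) (h : R -> R) (K L lam a b : R) (D : set nat)
    (al be : nat -> R) :
  0 <= K -> (forall x y, `|h x - h y| <= K * `|x - y|) -> a <= b ->
  (forall k, al k <= be k) ->
  (\esum_(k in D) (be k - al k)%:E <= lam%:E)%E ->
  (forall t, a <= t <= b ->
    (exists2 k, D k & al k <= t <= be k) \/ (derivable h t 1 /\ 'D_1 h t <= L)) ->
  h b - h a <= L * (b - a) + (K + `|L|) * lam.
Proof.
move=> K0 hK ab albe Hlam Hloc; apply/ler_addgt0Pr => e0 e0_gt0.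
pose M := K + `|L|.
have M0 : 0 <= M by rewrite addr_ge0.
have hKn x y : x <= y -> h y - h x <= K * (y - x).
  move=> xy; apply: (le_trans (ler_norm _)); apply: (le_trans (hK y x)).
  by rewrite ger0_norm ?subr_ge0.
pose e := e0 / (M + (b - a) + 1).
have den0 : 0 < M + (b - a) + 1 by lra.
have e_gt0 : 0 < e by rewrite divr_gt0.
have e_small : e * (b - a) + M * e <= e0.
  have : e * (M + (b - a) + 1) = e0 by rewrite /e divfK// gt_eqF.
  nra.
have [W [Wmono Wb Wcov]] := length_function albe e_gt0 Hlam.
pose bnd c := h c - h a <= (L + e) * (c - a) + M * W c.
suff : bnd b.
  have /andP[_ Wlam] := Wb b; rewrite /bnd => hb.
  have := ler_wpM2l M0 Wlam; rewrite -/M; nra.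
pose E := [set c | a <= c <= b /\ bnd c].
have Ea : E a.
  split; first by rewrite lexx ab.
  by rewrite /bnd !subrr mulr0 add0r mulr_ge0//; case/andP: (Wb a).
have supE : has_sup E.
  by split; [exists a|exists b => c [/andP[]]].
pose s := sup E.
have as_ : a <= s by apply: ub_le_sup => //; case: supE.
have sb : s <= b by apply: ge_sup; [exists a|move=> c [/andP[]]].
(* The bound passes to the supremum because [h] is Lipschitz and [W] is nondecreasing. *)
have bnds : bnd s.
  rewrite /bnd; apply/ler_addgt0Pr => d0 d0_gt0.
  pose d := d0 / (K + `|L + e| + 1).
  have dd : 0 < K + `|L + e| + 1 by rewrite ltr_wpDl// addr_ge0.
  have d_gt0 : 0 < d by rewrite divr_gt0.
  have dE : d * (K + `|L + e| + 1) = d0 by rewrite /d divfK// gt_eqF.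
  have [c [/andP[ac cb] bc] sc] := sup_adherent d_gt0 supE.
  have cs : c <= s by apply: ub_le_sup; [case: supE|split=> //; rewrite ac].
  have Wcs := ler_wpM2l M0 (Wmono _ _ cs).
  have hsc := hKn _ _ cs.
  have Ksc : K * (s - c) <= K * d by rewrite ler_wpM2l//; rewrite -/s in sc; lra.
  have Lsc : (L + e) * (c - s) <= `|L + e| * d.
    apply: (le_trans (ler_norm _)); rewrite normrM ler_wpM2l//.
    by rewrite ler0_norm ?subr_le0//; rewrite -/s in sc; lra.
  move: bc; rewrite /bnd => bc; nra.
have [|sb'] := leP b s; first by move=> bs; rewrite (le_anti (introT andP (conj bs sb))).
(* If [s < b], the bound holds at some point beyond the supremum, which is absurd. *)
suff [t st [tb bt]] : exists2 t, s < t & t <= b /\ bnd t.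
  have : t <= s by apply: ub_le_sup; [case: supE|split=> //; rewrite tb andbT; lra].
  by rewrite leNgt st.
have [[k Dk sk]|[dh hL]] := Hloc s (introT andP (conj as_ sb)).
  have [r r0 rW] := Wcov k s Dk sk.
  pose t := Num.min b (s + r / 2).
  have st : s < t by rewrite lt_min sb'/=; lra.
  have tb : t <= b by rewrite ge_min lexx.
  have tr : t <= s + r / 2 by rewrite ge_min lexx orbT.
  exists t => //; split => //.
  have W1 : W s + (t - s) <= W t by apply: rW; lra.
  have := ler_wpM2l M0 W1.
  have := hKn _ _ (ltW st).
  have : - `|L| * (t - s) <= L * (t - s).
    by rewrite ler_wpM2r ?subr_ge0 ?(ltW st)// lerNl -normrN ler_norm.
  have : 0 <= e * (t - s) by apply: mulr_ge0; rewrite ?subr_ge0 ltW.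
  move: bnds; rewrite /bnd /M => *; nra.
have : (fun u : R => u^-1 *: (h (u *: 1 + s) - h s)) @ 0^' --> 'D_1 h s.
  exact: dh.
move=> /cvgrPdist_lt /(_ _ e_gt0) /nbhs_ballP[r /= r0 Hr].
pose t := Num.min b (s + r / 2).
have st : s < t by rewrite lt_min sb'/=; lra.
have tb : t <= b by rewrite ge_min lexx.
have tr : t <= s + r / 2 by rewrite ge_min lexx orbT.
exists t => //; split => //.
have ts0 : 0 < t - s by rewrite subr_gt0.
have := Hr (t - s).
rewrite /ball/= sub0r normrN gtr0_norm// => /(_ _ _)/wrap[]; [by lra|by rewrite gt_eqF|].
rewrite [_ *: 1]mulr1 subrK ltr_distlC => /andP[_].
rewrite [_ *: _]mulrC ltr_pdivrMr// => hts.
have Wst := ler_wpM2l M0 (Wmono _ _ (ltW st)).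
have : ('D_1 h s + e) * (t - s) <= (L + e) * (t - s) by apply: ler_wpM2r; [exact: ltW|rewrite lerD2r].
move: bnds; rewrite /bnd => *; nra.
Qed.

Lemma row_norm_le (R : realType) n (v : 'rV[R]_n) (r : R) :
  0 <= r -> (forall i, `|v 0 i| <= r) -> `|v| <= r.
Proof.
move=> r0 vr; rewrite [leLHS]/Num.Def.normr/= mx_normrE (bigmax_le _ r0)//=.
by move=> [i j] _ /=; rewrite ord1.
Qed.

Lemma coord_le_norm (R : realType) n (v : 'rV[R]_n) i : `|v 0 i| <= `|v|.
Proof.
rewrite [leRHS]/Num.Def.normr/= mx_normrE.
exact: (le_bigmax _ _ (0, i)).
Qed.

Lemma lipschitzE (R : realType) (V W : normedModType R) (f : V -> W) (A : set V) :
  [lipschitz f x | x in A] ->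
  exists2 K : R, 0 <= K & forall x y, A x -> A y -> `|f x - f y| <= K * `|x - y|.
Proof.
move=> [M [_ HM]]; exists (Num.max M 0 + 1).
  by rewrite addr_ge0// le_max lexx orbT.
move=> x y Ax Ay; apply: (HM _ _ (x, y)) => //.
by rewrite ltr_pwDr// le_max lexx.
Qed.

(* The covering boxes cut every line parallel to [e_i] in intervals. By
   [box_cover_weight] their total length is small for some line passing near [x],
   and by continuity this line suffices. *)
Lemma ae_derive_le (R : realType) n (f : 'rV[R]_n -> R) (K L : R) (i : 'I_n) :
  0 <= K -> (forall x y, `|f x - f y| <= K * `|x - y|) ->
  ae_in setT (fun x => derivable f x (delta_mx 0 i) /\ 'D_(delta_mx 0 i) f x <= L) ->
  forall x t, 0 <= t -> f (x + t *: delta_mx 0 i) - f x <= L * t.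
Proof.
move=> K0 fK Hae x t t0; apply/ler_addgt0Pr => e e0.
pose ei : 'rV[R]_n := delta_mx 0 i.
have eiE j : ei 0 j = (j == i)%:R by rewrite mxE eqxx.
have nei : `|ei| <= 1.
  by apply: row_norm_le => // j; rewrite eiE; case: (j == i); rewrite ?normr1 ?normr0.
pose M := K + `|L|.
have M0 : 0 <= M by rewrite addr_ge0.
(* [lam] will bound the length of the bad part of the line and [r] the shift of the line; each error
   costs at most half of [e]. *)
pose lam := e / (2 * (M + 1)); pose r := e / (4 * (K + 1)).
have M1 : 0 < 2 * (M + 1) by lra.
have K1 : 0 < 4 * (K + 1) by lra.
have lam0 : 0 < lam by rewrite divr_gt0.
have r0 : 0 < r by rewrite divr_gt0.
have lamM : M * lam <= e / 2.
  have : lam * (2 * (M + 1)) = e by rewrite /lam divfK// gt_eqF.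
  nra.
have rK : 2 * (K * r) <= e / 2.
  have : r * (4 * (K + 1)) = e by rewrite /r divfK// gt_eqF.
  nra.
pose s := [seq j <- enum 'I_n | j != i].
have us : uniq s by rewrite filter_uniq// enum_uniq.
have sE j : (j \in s) = (j != i) by rewrite mem_filter mem_enum andbT.
have prodE (F : 'I_n -> R) : \prod_j F j = F i * \prod_(j <- s) F j.
  by rewrite (bigD1 i)//= big_filter big_enum_cond.
pose Q := \prod_(j <- s) ((x 0 j + r) - (x 0 j - r)).
have Q0 : 0 < Q by rewrite prodr_gt0// => j _; lra.
(* If every line through the cross-section of volume [Q] met the boxes in length more than [lam],
   their total volume would be at least [lam * Q]; half of this gives a strict contradiction. *)
have eps0 : 0 < lam * Q / 2 by rewrite divr_gt0// mulr_gt0.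
have [D [a [b [ab Acov vol]]]] := Hae _ eps0.
have [y yx ysum] : exists2 y : 'I_n -> R,
    {in s, forall j, x 0 j - r <= y j <= x 0 j + r} &
    (\esum_(k in D `&` [set k | {in s, forall j, (a k 0 j <= y j <= b k 0 j)%R}])
      (b k 0 i - a k 0 i)%:E <= lam%:E)%E.
  apply: contrapT => Hno.
  have : ((lam * Q)%:E <= \esum_(k in D)
      ((b k 0 i - a k 0 i) * \prod_(j <- s) (b k 0 j - a k 0 j))%:E)%E.
    apply: (@box_cover_weight _ _ s D (fun k => b k 0 i - a k 0 i)
      (fun k => a k 0) (fun k => b k 0) (fun j => x 0 j - r) (fun j => x 0 j + r)) => //.
    - by move=> k; rewrite subr_ge0.
    - by move=> j; lra.
    - exact: ltW.
    - by move=> y yx; rewrite leNgt; apply/negP => /ltW ysum; apply: Hno; exists y.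
  rewrite leNgt => /negP; apply.
  rewrite (eq_esum (b := fun k => (\prod_j (b k 0 j - a k 0 j))%:E)); last first.
    by move=> k _; rewrite prodE.
  apply: (le_lt_trans vol); rewrite lte_fin.
  have := mulr_gt0 lam0 Q0; lra.
pose z : 'rV[R]_n := \row_j (if j == i then x 0 i else y j).
have zi : z 0 i = x 0 i by rewrite mxE eqxx.
have zx : `|z - x| <= r.
  apply: row_norm_le; first exact: ltW.
  move=> j; rewrite !mxE; case: eqP => [->|/eqP ji]; first by rewrite subrr normr0 ltW.
  have : j \in s by rewrite sE.
  by move=> /yx h; rewrite ler_distlC; lra.
pose h (u : R) := f (z + u *: ei).
pose D' := D `&` [set k | {in s, forall j, (a k 0 j <= y j <= b k 0 j)%R}].
have : h t - h 0 <= L * (t - 0) + (K + `|L|) * lam.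
  apply: (@growth_bound _ h K L lam 0 t D' (fun k => a k 0 i - x 0 i)
    (fun k => b k 0 i - x 0 i)) => //.
  - move=> u v; apply: (le_trans (fK _ _)); rewrite ler_wpM2l//.
    rewrite opprD addrACA subrr add0r -scalerBl normrZ.
    by rewrite -[leRHS]mulr1 ler_wpM2l.
  - by move=> k; rewrite lerD2r.
  - rewrite (eq_esum (b := fun k => (b k 0 i - a k 0 i)%:E))// => k _.
    by congr (_%:E); lra.
  - move=> u _; set p := z + u *: ei.
    have pj j : j != i -> p 0 j = y j.
      by move=> ji; rewrite mxE [(u *: ei) 0 j]mxE eiE mxE (negbTE ji) mulr0 addr0.
    have pi_ : p 0 i = x 0 i + u by rewrite mxE [(u *: ei) 0 i]mxE eiE zi eqxx mulr1.
    (* An exceptional point of the line lies in some box, hence in one of the intervals of [D']. *)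
    have [good|bad] := pselect (derivable f p ei /\ 'D_ei f p <= L); last first.
      left; have [k Dk pk] : (\bigcup_(k in D) box (a k) (b k)) p by exact: Acov.
      exists k.
        by split => // j; rewrite sE => ji; rewrite -(pj _ ji).
      by have := pk i; rewrite pi_; lra.
    right; move: good.
    rewrite /derivable /derive /h.
    suff -> : (fun h0 : R => h0^-1 *: ((f \o shift p) (h0 *: ei) - f p)) =
        (fun h0 : R => h0^-1 *: (((fun v => f (z + v *: ei)) \o shift u) (h0 *: 1) - f (z + u *: ei))).
      by [].
    apply/funext => v /=; rewrite [_ *: 1]mulr1 -/p; congr (_ *: (f _ - _)).
    by rewrite scalerDl /p addrCA.
rewrite subr0 /h scale0r addr0 -/M => hz.
have h1 : f (x + t *: ei) - f (z + t *: ei) <= K * r.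
  apply: (le_trans (ler_norm _)); apply: (le_trans (fK _ _)); rewrite ler_wpM2l//.
  by rewrite opprD addrACA subrr addr0 distrC.
have h2 : f z - f x <= K * r.
  apply: (le_trans (ler_norm _)); apply: (le_trans (fK _ _)); rewrite ler_wpM2l//.
lra.
Qed.

Lemma coord_le_enorm (R : realType) n (v : 'rV[R]_n) i : `|v 0 i| <= enorm v.
Proof.
rewrite -sqrtr_sqr ler_wsqrtr// big_ord1 (bigD1 i)//= lerDl.
by rewrite sumr_ge0// => j _; exact: sqr_ge0.
Qed.

Lemma ae_in_mono (R : realType) n (D : set 'rV[R]_n) (P Q : 'rV[R]_n -> Prop) :
  (forall x, P x -> Q x) -> ae_in D P -> ae_in D Q.
Proof.
move=> PQ HP e e0; have [E [a [b [ab cov vol]]]] := HP e e0.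
exists E, a, b; split => // x [Dx nQ]; apply: cov; split => // Px.
exact/nQ/PQ.
Qed.

(** Apply [ae_derive_le] to [f] and to [- f]; a negative [t] exchanges the two end points. *)
Lemma lipschitz_grad_le_coord (R : realType) n (f : 'rV[R]_n -> R) (L : R) :
  lipschitz_grad_le f L ->
  forall x i t, `|f (x + t *: delta_mx 0 i) - f x| <= L * `|t|.
Proof.
move=> [/lipschitzE[K K0 fK] Hae] x i t.
have {}fK y z := fK y z I I.
have key y s : 0 <= s -> `|f (y + s *: delta_mx 0 i) - f y| <= L * s.
  move=> s0; rewrite ler_norml; apply/andP; split; last first.
    apply: (ae_derive_le K0 fK) => //; apply: ae_in_mono Hae => u [df gf].
    split; first exact: diff_derivable.
    apply: le_trans gf; apply: le_trans (coord_le_enorm _ i).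
    by rewrite mxE ler_norm.
  rewrite lerNl opprB addrC -[f y]opprK.
  apply: (@ae_derive_le _ _ (fun u => - f u) K L) => //.
    by move=> u v; rewrite -opprD normrN.
  apply: ae_in_mono Hae => u [df gf]; have duf : derivable f u (delta_mx 0 i) by exact: diff_derivable.
  split; first exact: derivableN.
  rewrite (deriveN duf); apply: le_trans gf; apply: le_trans (coord_le_enorm _ i).
  by rewrite mxE -normrN ler_norm.
have [t0|t0] := leP 0 t; first by rewrite (ger0_norm t0); exact: key.
have Nt : 0 <= - t by rewrite oppr_ge0 ltW.
by have := key (x + t *: delta_mx 0 i) (- t) Nt; rewrite scaleNr addrK distrC (ltr0_norm t0).
Qed.

(** Going from [y] to [x] by changing one coordinate at a time produces the l^1 norm. *)
Lemma lipschitz_grad_le_sum (R : realType) n (f : 'rV[R]_n -> R) (L : R) :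
  lipschitz_grad_le f L ->
  forall x y, `|f x - f y| <= L * \sum_i `|x 0 i - y 0 i|.
Proof.
move=> fL x y; have fc := lipschitz_grad_le_coord fL.
pose z (s : seq 'I_n) : 'rV[R]_n := \row_i (if i \in s then x 0 i else y 0 i).
have key (s : seq 'I_n) : uniq s -> `|f (z s) - f y| <= L * \sum_(i <- s) `|x 0 i - y 0 i|.
  elim: s => [_|i s IH /= /andP[si us]].
    rewrite big_nil mulr0 normr_le0 subr_eq0; apply/eqP; congr f.
    by apply/rowP => j; rewrite mxE.
  have -> : z (i :: s) = z s + (x 0 i - y 0 i) *: delta_mx 0 i.
    apply/rowP => j; rewrite !mxE inE eqxx/=.
    have [->|ji] := eqVneq j i; last by rewrite mulr0 addr0.
    by rewrite (negbTE si) mulr1 addrC subrK.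
  rewrite big_cons mulrDr; apply: le_trans (lerD (fc (z s) i _) (IH us)).
  exact: ler_distD.
have := key (enum 'I_n) (enum_uniq _); rewrite big_enum/=.
suff -> : z (enum 'I_n) = x by [].
by apply/rowP => j; rewrite mxE mem_enum.
Qed.

Lemma lipschitz_grad_le_ge0 (R : realType) n (f : 'rV[R]_n.+1 -> R) (L : R) :
  lipschitz_grad_le f L -> 0 <= L.
Proof.
move=> fL; have := lipschitz_grad_le_coord fL 0 0 1.
by rewrite normr1 mulr1; apply: le_trans.
Qed.

(** * Functions of controlled size at a given scale *)

(** The first-order expansion of [f] at [x] serves for [g], with the same linear part. *)
Lemma near_eq_differentiable (R : numFieldType) (V W : normedModType R)
    (f g : V -> W) (x : V) :
  {near x, f =1 g} -> differentiable f x -> differentiable g x.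
Proof.
move=> fg df; have [dfc /eqaddoP H] := (diff_locallyP x f).1 df.
have fg0 : \forall y \near (0 : V), f (y + x) = g (y + x).
  by have := fg; rewrite (near_shift 0 x) subr0.
have E : g \o shift x = cst (g x) + 'd f x +o_ 0 id.
  apply/eqaddoP => e e0; apply: filterS2 (H e e0) fg0 => y Hy fgy.
  suff -> : (g \o shift x - (cst (g x) + 'd f x)) y =
            (f \o shift x - (cst (f x) + 'd f x)) y by [].
  by rewrite !fctE /= -fgy (nbhs_singleton fg).
apply/diff_locallyP; have -> : 'd g x = 'd f x :> (V -> W) by exact: diff_unique.
by [].
Qed.

Lemma differentiable_row (R : realType) (V : normedModType R) n (F : V -> 'rV[R]_n) x :
  (forall j, differentiable (fun y => F y 0 j) x) -> differentiable F x.
Proof.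
move=> dF; have -> : F = \sum_j (fun y => F y 0 j *: delta_mx 0 j).
  apply/funext => y; rewrite fct_sumE [LHS]row_sum_delta.
  by [].
by apply: differentiable_sum => j; exact: differentiableZl.
Qed.

Lemma derive_comp_real (R : realType) (V : normedModType R) (f : V -> R)
    (phi : R -> R) (a : R) (y v : V) :
  differentiable f y -> is_derive (f y) 1 phi a ->
  differentiable (phi \o f) y /\ 'D_v (phi \o f) y = a * 'D_v f y.
Proof.
move=> df [dphi phia].
have dphi' : differentiable phi (f y) by exact/derivable1_diffP.
have dc := differentiable_comp df dphi'.
split => //; rewrite !deriveE// diff_comp//= diff1E//.
by rewrite derive1E phia mulrC.
Qed.

Section TwiceDifferentiable.
Context {R : realType} {n : nat}.
Implicit Types (f g : 'rV[R]_n -> R) (x y : 'rV[R]_n) (M rho : R).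

Definition pd (i : 'I_n) f x : R := 'D_(delta_mx 0 i) f x.

(* The bounds are those of a function of size [M] varying at scale [rho]. *)
Definition c2_le f x M rho : Prop :=
  [/\ \forall y \near x, differentiable f y,
      forall i, differentiable (pd i f) x,
      `|f x| <= M, forall i, `|pd i f x| <= M / rho &
      forall i j, `|pd j (pd i f) x| <= M / rho ^+ 2].

Lemma c2_le_ge0 f x M rho : c2_le f x M rho -> 0 <= M.
Proof. by case=> _ _ fM _ _; exact: le_trans fM. Qed.

Lemma near_eq_c2_le f g x M rho :
  {near x, f =1 g} -> c2_le f x M rho -> c2_le g x M rho.
Proof.
move=> fg [df ddf fM dfM ddfM]; have fg' := nbhs_interior fg.
have pdfg i : {near x, pd i f =1 pd i g}.
  by apply: filterS fg' => y fgy; exact: near_eq_derive.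
split.
- by apply: filterS2 fg' df => y; exact: near_eq_differentiable.
- by move=> i; apply: near_eq_differentiable (pdfg i) (ddf i).
- by rewrite -(nbhs_singleton fg).
- by move=> i; rewrite -(nbhs_singleton (pdfg i)).
- by move=> i j; rewrite /pd -(near_eq_derive _ (pdfg i)); exact: ddfM.
Qed.

Lemma c2_le_mono f x M M' rho :
  0 < rho -> M <= M' -> c2_le f x M rho -> c2_le f x M' rho.
Proof.
move=> rho0 MM' [df ddf fM dfM ddfM]; split => //; first exact: le_trans MM'.
- move=> i; apply: le_trans (dfM i) _; rewrite ler_wpM2r// invr_ge0.
  exact: ltW.
- move=> i j; apply: le_trans (ddfM i j) _; rewrite ler_wpM2r// invr_ge0.
  by rewrite exprn_ge0// ltW.
Qed.

Lemma c2_le_cst (c : R) x rho : 0 < rho -> c2_le (cst c) x `|c| rho.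
Proof.
move=> rho0; have pd0 i : pd i (cst c) = cst 0.
  by apply/funext => y; rewrite /pd derive_cst.
split => //.
- by apply/nbhs_ballP; exists 1 => //= y _; exact: differentiable_cst.
- by move=> i; rewrite pd0; exact: differentiable_cst.
- by move=> i; rewrite pd0 normr0 divr_ge0// ltW.
- by move=> i j; rewrite pd0 /pd derive_cst normr0 divr_ge0// exprn_ge0// ltW.
Qed.

Lemma c2_leD f g x M1 M2 rho :
  c2_le f x M1 rho -> c2_le g x M2 rho -> c2_le (f \+ g) x (M1 + M2) rho.
Proof.
move=> [df ddf fM dfM ddfM] [dg ddg gM dgM ddgM].
have pdD i : {near x, pd i f \+ pd i g =1 pd i (f \+ g)}.
  apply: filterS2 df dg => y dfy dgy.
  by rewrite /pd deriveD//; exact: diff_derivable.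
split.
- by apply: filterS2 df dg => y dfy dgy; exact: differentiableD.
- by move=> i; apply: near_eq_differentiable (pdD i) _; exact: differentiableD.
- exact: le_trans (ler_normD _ _) (lerD _ _).
- move=> i; rewrite -(nbhs_singleton (pdD i)) mulrDl.
  exact: le_trans (ler_normD _ _) (lerD _ _).
- move=> i j; rewrite {1}/pd -(near_eq_derive _ (pdD i)) mulrDl.
  rewrite deriveD; [|exact: diff_derivable..].
  by apply: (le_trans (ler_normD _ _)); apply: lerD; [exact: ddfM|exact: ddgM].
Qed.

Lemma c2_le_sum (I : eqType) (s : seq I) (F : I -> 'rV[R]_n -> R) x (M : I -> R) rho :
  0 < rho -> {in s, forall i, c2_le (F i) x (M i) rho} ->
  c2_le (fun y => \sum_(i <- s) F i y) x (\sum_(i <- s) M i) rho.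
Proof.
move=> rho0; elim: s => [_|i s IH HF].
  have -> : (fun y => \sum_(i <- [::]) F i y) = cst 0.
    by apply/funext => y; rewrite big_nil.
  by rewrite big_nil; have := c2_le_cst 0 x rho0; rewrite normr0.
have -> : (fun y => \sum_(i <- i :: s) F i y) =
    F i \+ (fun y => \sum_(i <- s) F i y).
  by apply/funext => y; rewrite big_cons.
rewrite big_cons; apply: c2_leD; first by apply: HF; exact: mem_head.
by apply: IH => j js; apply: HF; rewrite inE js orbT.
Qed.

(** The factor 4 counts the terms of the Leibniz formula for a second derivative. *)
Lemma c2_leM f g x M1 M2 rho : 0 < rho ->
  c2_le f x M1 rho -> c2_le g x M2 rho -> c2_le (f \* g) x (4 * (M1 * M2)) rho.
Proof.
move=> rho0 cf cg; have M10 := c2_le_ge0 cf; have M20 := c2_le_ge0 cg.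
case: cf cg => [df ddf fM dfM ddfM] [dg ddg gM dgM ddgM].
have pdM i : {near x, (f \* pd i g) \+ (g \* pd i f) =1 pd i (f \* g)}.
  apply: filterS2 df dg => y dfy dgy.
  by rewrite /pd deriveM//; exact: diff_derivable.
have dfx : differentiable f x := nbhs_singleton df.
have dgx : differentiable g x := nbhs_singleton dg.
have normM (a b A B : R) : `|a| <= A -> `|b| <= B -> `|a * b| <= A * B.
  by move=> aA bB; rewrite normrM ler_pM.
have M12 : 0 <= M1 * M2 by rewrite mulr_ge0.
split.
- by apply: filterS2 df dg => y dfy dgy; exact: differentiableM.
- move=> i; apply: near_eq_differentiable (pdM i) _.
  by apply: differentiableD; exact: differentiableM.
- by apply: (le_trans (normM _ _ _ _ fM gM)); lra.
- move=> i; rewrite -(nbhs_singleton (pdM i)).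
  apply: (le_trans (ler_normD _ _)).
  apply: (le_trans (lerD (normM _ _ _ _ fM (dgM i)) (normM _ _ _ _ gM (dfM i)))).
  rewrite (_ : _ + _ = 2 * (M1 * M2) / rho); last by field; rewrite gt_eqF.
  by rewrite ler_wpM2r ?invr_ge0 ?(ltW rho0)//; lra.
- move=> i j; rewrite {1}/pd -(near_eq_derive _ (pdM i)).
  rewrite deriveD; [|by apply: diff_derivable; exact: differentiableM..].
  rewrite deriveM; [|exact: diff_derivable..].
  rewrite deriveM; [|exact: diff_derivable..].
  rewrite -![_ *: _]/(_ * _) -!/(pd _ _ _).
  apply: (le_trans (ler_normD _ _)); apply: (le_trans (lerD (ler_normD _ _) (ler_normD _ _))).
  have h1 := normM _ _ _ _ fM (ddgM i j).
  have h2 := normM _ _ _ _ (dgM i) (dfM j).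
  have h3 := normM _ _ _ _ gM (ddfM i j).
  have h4 := normM _ _ _ _ (dfM i) (dgM j).
  apply: (le_trans (lerD (lerD h1 h2) (lerD h3 h4))).
  by rewrite le_eqVlt; apply/orP; left; apply/eqP; field; rewrite gt_eqF.
Qed.

(** [K] bounds the outer function and its first two derivatives at [f x]; the terms [M] and [M ^+ 2]
    come from phi' D^2 f and phi'' Df Df. *)
Lemma c2_le_comp f (phi phi1 : R -> R) (a K : R) x M rho : 0 < rho ->
  c2_le f x M rho -> (\forall u \near f x, is_derive (u : R) (1 : R) phi (phi1 u)) ->
  is_derive (f x) 1 phi1 a ->
  `|phi (f x)| <= K -> `|phi1 (f x)| <= K -> `|a| <= K ->
  c2_le (phi \o f) x (K * (1 + M + M ^+ 2)) rho.
Proof.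
move=> rho0 cf dphi dphi1 K1 K2 K3; have M0 := c2_le_ge0 cf.
have K0 : 0 <= K := le_trans (normr_ge0 _) K1.
case: cf => [df ddf fM dfM ddfM].
have dfx : differentiable f x := nbhs_singleton df.
have dphif : \forall y \near x, is_derive (f y) 1 phi (phi1 (f y)).
  exact: (differentiable_continuous dfx) dphi.
have pdC i : {near x, (phi1 \o f) \* pd i f =1 pd i (phi \o f)}.
  apply: filterS2 df dphif => y dfy dy /=.
  by rewrite {2}/pd (derive_comp_real _ dfy dy).2.
have [dphi1f _] := derive_comp_real 0 dfx dphi1.
have normM (u b A B : R) : `|u| <= A -> `|b| <= B -> `|u * b| <= A * B.
  by move=> aA bB; rewrite normrM ler_pM.
have M2 : 0 <= M ^+ 2 by exact: sqr_ge0.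
split.
- by apply: filterS2 df dphif => y dfy dy; have [] := derive_comp_real 0 dfy dy.
- by move=> i; apply: near_eq_differentiable (pdC i) _; exact: differentiableM.
- by apply: (le_trans K1); rewrite ler_peMr//; lra.
- move=> i; rewrite -(nbhs_singleton (pdC i)).
  apply: (le_trans (normM _ _ _ _ K2 (dfM i))).
  by rewrite mulrA ler_wpM2r ?invr_ge0 ?(ltW rho0)// ler_wpM2l//; lra.
- move=> i j; rewrite {1}/pd -(near_eq_derive _ (pdC i)).
  rewrite deriveM; [|exact: diff_derivable..].
  rewrite (derive_comp_real _ dfx dphi1).2 -![_ *: _]/(_ * _) -!/(pd _ _ _).
  apply: (le_trans (ler_normD _ _)).
  have h1 := normM _ _ _ _ K2 (ddfM i j).
  have h2 := normM _ _ _ _ (dfM i) (normM _ _ _ _ K3 (dfM j)).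
  apply: (le_trans (lerD h1 h2)).
  rewrite [leLHS](_ : _ = K * (M + M ^+ 2) / rho ^+ 2); last by field; rewrite gt_eqF.
  rewrite ler_wpM2r ?invr_ge0 ?exprn_ge0 ?(ltW rho0)// ler_wpM2l//; lra.
Qed.

Lemma pd_coord (k i : 'I_n) (c : R) y :
  pd i (fun z : 'rV[R]_n => z 0 k - c) y = (k == i)%:R.
Proof.
rewrite /pd deriveB; last 2 first.
- by apply: diff_derivable; exact: differentiable_coord.
- exact: derivable_cst.
rewrite derive_cst subr0.
have did : derivable (id : 'rV[R]_n -> 'rV[R]_n) y (delta_mx 0 i).
  exact: derivable_id.
have /matrixP/(_ 0 k) := derive_mx did.
by rewrite derive_id !mxE eqxx.
Qed.

(** The gradient has size 1, which [M / rho] must dominate; hence the hypothesis [rho <= M]. *)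
Lemma c2_le_coord (k : 'I_n) (c : R) x M rho : 0 < rho ->
  `|x 0 k - c| <= M -> rho <= M -> c2_le (fun y => y 0 k - c) x M rho.
Proof.
move=> rho0 xM rhoM; have M0 : 0 <= M := le_trans (normr_ge0 _) xM.
have dkc y : differentiable (fun z : 'rV[R]_n => z 0 k - c) y.
  by apply: differentiableB; [exact: differentiable_coord|exact: differentiable_cst].
have pdk i : pd i (fun z => z 0 k - c) = cst ((k == i)%:R).
  by apply/funext => y; exact: pd_coord.
split => //.
- by apply/nbhs_ballP; exists 1 => /=.
- by move=> i; rewrite pdk; exact: differentiable_cst.
- move=> i; rewrite pdk /= ler_pdivlMr//; apply: le_trans rhoM.
  by case: (k == i); rewrite ?normr1 ?normr0 ?mul1r ?mul0r// ltW.
- by move=> i j; rewrite pdk /pd derive_cst normr0 divr_ge0// exprn_ge0// ltW.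
Qed.

Lemma differentiable_grad f x M rho : c2_le f x M rho -> differentiable (grad f) x.
Proof.
move=> [_ ddf _ _ _]; apply: differentiable_row => j.
by rewrite (_ : (fun y => _) = pd j f)//; apply/funext => y; rewrite mxE.
Qed.

(** Jacobians act on row vectors from the right: the row index is the direction of the outer
    derivative, the column index the component of the gradient. *)
Lemma hessE f x M rho i j : c2_le f x M rho -> hess f x i j = pd i (pd j f) x.
Proof.
move=> cf; have dg := differentiable_grad cf.
rewrite /hess /jacobian mxE -(deriveE _ dg) derive_mx; last exact: diff_derivable.
rewrite mxE (_ : (fun y => grad f y 0 j) = pd j f)//.
by apply/funext => y; rewrite mxE.
Qed.

End TwiceDifferentiable.

(** The sharp factor is the square root of [p * q]; the larger [p * q] keeps the constants free of
    roots. *)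
Lemma enorm_le_entry (R : realType) p q (A : 'M[R]_(p, q)) (B : R) :
  (forall i j, `|A i j| <= B) -> enorm A <= (p * q)%:R * B.
Proof.
(* [B] may be negative when there are no entries, so empty matrices are treated apart. *)
case: p A => [A _|p A]; first by rewrite /enorm big_ord0 sqrtr0 mul0n mul0r.
case: q A => [A _|q A AB].
  by rewrite /enorm big1 ?sqrtr0 ?muln0 ?mul0r// => i _; rewrite big_ord0.
have B0 : 0 <= B by apply: le_trans (AB 0 0).
have pq0 : 0 <= (p.+1 * q.+1)%:R * B by rewrite mulr_ge0.
rewrite -(ler_pXn2r (ltn0Sn 1)) ?nnegrE ?sqrtr_ge0//.
rewrite sqr_sqrtr; last first.
  by apply: sumr_ge0 => i _; apply: sumr_ge0 => j _; exact: sqr_ge0.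
apply: (@le_trans _ _ (\sum_(i < p.+1) \sum_(j < q.+1) B ^+ 2)).
  apply: ler_sum => i _; apply: ler_sum => j _.
  by rewrite -real_normK ?num_real// lerXn2r ?nnegrE.
rewrite !sumr_const !card_ord -mulrnA exprMn -[leLHS]mulr_natl ler_wpM2r ?sqr_ge0//.
by rewrite -natrX ler_nat mulnC -[leqLHS]expn1 leq_pexp2l// muln_gt0.
Qed.

(** * Smoothing at the scale of the distance *)

(** At 0 the difference quotient is bounded by a positive power of [|h|]. Applied to the cube and
    then to the square, this makes the cube of the positive part twice differentiable. *)
Lemma is_derive_max0X (R : realType) (k : nat) (u : R) :
  is_derive u (1 : R) (fun t : R => Num.max t 0 ^+ k.+2) (k.+2%:R * Num.max u 0 ^+ k.+1).
Proof.
have [u0|u0|->] := ltgtP u 0.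
- rewrite expr0n mulr0.
  apply: (near_eq_is_derive (f := (cst 0 : R -> R))).
  have := lt_nbhsl u0; apply: filterS => t /= t0.
  by rewrite max_r ?(ltW t0)// expr0n.
- apply: (near_eq_is_derive (f := ((id : R -> R) ^+ k.+2))).
    have := lt_nbhsr u0; apply: filterS => t /= t0.
    by rewrite max_l ?(ltW t0)// exprfctE.
  by apply: is_derive_eq; rewrite [_ *: _]mulr1.
- rewrite expr0n mulr0.
  suff H : (fun h : R => h^-1 *: (((fun t : R => Num.max t 0 ^+ k.+2) \o shift 0) (h *: 1)
      - Num.max 0 0 ^+ k.+2)) @ 0^' --> (0 : R).
    by apply: DeriveDef; [exact: cvgP H|exact: cvg_lim H].
  apply/cvgr0Pnorm_le => e e0; near=> h.
  have h0 : h != 0 by near: h; exact: nbhs_dnbhs_neq.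
  have hm : `|h| < Num.min e 1.
    by near: h; apply: dnbhs0_lt; rewrite lt_min e0 ltr01.
  move: hm; rewrite lt_min => /andP[he h1].
  rewrite /= addr0 [h *: 1]mulr1 maxxx expr0n subr0 [_ *: _]mulrC normrM normfV.
  rewrite ler_pdivrMr ?normr_gt0//.
  have m1 : `|Num.max h 0| <= `|h|.
    by have [h0'|h0'] := leP h 0; rewrite ?normr0.
  rewrite normrX; apply: (@le_trans _ _ (`|h| ^+ k.+2)); first by rewrite lerXn2r ?nnegrE.
  rewrite exprSr ler_wpM2r//; apply: le_trans (ltW he).
  by rewrite exprS ler_piMr// exprn_ile1// ltW.
Unshelve. all: by end_near. Qed.

Lemma is_derive_inv (R : realType) (u : R) : u != 0 ->
  is_derive u (1 : R) (fun t : R => t^-1) (- u ^- 2).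
Proof.
move=> u0; have did : derivable (id : R -> R) u 1 by exact: derivable_id.
apply: DeriveDef; first exact: (@derivableV _ _ id u 1 u0 did).
by have := @deriveV _ _ id u 1 u0 did; rewrite derive_id [_ *: _]mulr1.
Qed.

Lemma is_derive_invX2 (R : realType) (u : R) : u != 0 ->
  is_derive u (1 : R) (fun t : R => - t ^- 2) (2 * u ^- 3).
Proof.
move=> u0; have u2 : u ^+ 2 != 0 by rewrite expf_neq0.
have dX : derivable ((id : R -> R) ^+ 2) u 1 by apply: derivableX; exact: derivable_id.
have u2' : ((id : R -> R) ^+ 2) u != 0 by rewrite exprfctE.
have dV := @derivableV _ _ _ u 1 u2' dX.
have -> : (fun t : R => - t ^- 2) = (- (fun t : R => (((id : R -> R) ^+ 2) t)^-1)).
  by apply/funext => t; rewrite !fctE.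
apply: DeriveDef; first exact: derivableN.
rewrite (deriveN dV) (deriveV u2' dX) deriveX; last exact: derivable_id.
rewrite derive_id /= exprfctE.
by rewrite -![_ *: _]/(_ * _) expr1; field.
Qed.

(** * Compactly supported bumps of class C^2 *)

Section Bump.
Context {R : realType} {n : nat}.
Implicit Types (p x y : 'rV[R]_n) (r d : R).

(** The support is the Euclidean ball of radius [r]; the cube is the least integer power of the
    positive part that is twice differentiable. *)
Definition bump p r y : R :=
  Num.max (1 - \sum_k ((y 0 k - p 0 k) / r) ^+ 2) 0 ^+ 3.

Lemma bump_ge0 p r y : 0 <= bump p r y.
Proof. by rewrite exprn_ge0// le_max lexx orbT. Qed.

Lemma bump_supp p r y : 0 < r -> bump p r y != 0 -> `|y - p| <= r.
Proof.
move=> r0; rewrite /bump expf_eq0/=.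
have [_|Slt1] := leP (1 - \sum_k ((y 0 k - p 0 k) / r) ^+ 2) 0; first by rewrite eqxx.
move=> _; apply: row_norm_le => [|i]; first exact: ltW.
have : ((y 0 i - p 0 i) / r) ^+ 2 <= 1.
  apply: (@le_trans _ _ (\sum_k ((y 0 k - p 0 k) / r) ^+ 2)); last by lra.
  by rewrite (bigD1 i)//= lerDl sumr_ge0// => k _; exact: sqr_ge0.
rewrite !mxE -real_normK ?num_real// expr_le1//.
by rewrite normrM normfV (gtr0_norm r0) ler_pdivrMr// mul1r.
Qed.

Lemma bump_ge p r y : \sum_k ((y 0 k - p 0 k) / r) ^+ 2 <= 1 / 2 -> 1 / 8 <= bump p r y.
Proof.
move=> h; rewrite (_ : 1 / 8 = (1 / 2) ^+ 3); last by field.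
apply: lerXn2r; rewrite ?nnegrE ?le_max ?lexx ?orbT//.
by apply/orP; left; lra.
Qed.

(** Here 880 = 4 * 11 * 20 controls a coordinate of (y - p) / r: the numerator has size [11 * d],
    the factor 1 / r is at most 20 / d, and [c2_leM] costs a factor 4. *)
Definition bump_quad_bound : R := 1 + 4 * (n%:R * (4 * (880 * 880))).

(** On [0, 1] the functions t^3, 3 t^2 and 6 t are at most 6. *)
Definition bump_bound : R := 6 * (1 + bump_quad_bound + bump_quad_bound ^+ 2).

(** As [r] is comparable to [d], the rescaled quadratic varies at scale [d]; [c2_le_comp] then
    applies the cube of the positive part. *)
Lemma c2_le_bump p r y d : 0 < d -> d / 20 <= r -> r <= d -> `|y - p| <= 11 * r ->
  c2_le (bump p r) y bump_bound d.
Proof.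
move=> d0 dr rd yp; have r0 : 0 < r by lra.
have ck k : c2_le (fun z : 'rV[R]_n => ((z 0 k - p 0 k) / r) ^+ 2) y (4 * (880 * 880)) d.
  have c1 : c2_le (fun z : 'rV[R]_n => z 0 k - p 0 k) y (11 * d) d.
    apply: c2_le_coord => //; last by lra.
    apply: (@le_trans _ _ (`|y - p|)); last by lra.
    by have := coord_le_norm (y - p) k; rewrite !mxE.
  have c2 : c2_le (fun z : 'rV[R]_n => (z 0 k - p 0 k) / r) y 880 d.
    apply: c2_le_mono (c2_leM d0 c1 (c2_le_cst r^-1 y d0)) => //.
    rewrite ger0_norm ?invr_ge0 ?(ltW r0)// mulrA ler_pdivrMr//.
    by lra.
  exact: (c2_leM d0 c2 c2).
have cS := @c2_le_sum R n _ (index_enum 'I_n) _ y (fun=> 4 * (880 * 880)) d d0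
  (fun k _ => ck k).
have cq : c2_le (fun z : 'rV[R]_n => 1 - \sum_k ((z 0 k - p 0 k) / r) ^+ 2) y bump_quad_bound d.
  have -> : (fun z : 'rV[R]_n => 1 - \sum_k ((z 0 k - p 0 k) / r) ^+ 2) =
      cst 1 \+ (cst (-1) \* (fun z : 'rV[R]_n => \sum_k ((z 0 k - p 0 k) / r) ^+ 2)).
    by apply/funext => z /=; rewrite mulN1r.
  apply: c2_le_mono (c2_leD (c2_le_cst 1 y d0) (c2_leM d0 (c2_le_cst (-1) y d0) cS)) => //.
  by rewrite normrN normr1 mul1r sumr_const card_ord -[X in 4 * X]mulr_natl.
set q := (1 - \sum_k ((y 0 k - p 0 k) / r) ^+ 2).
have q1 : q <= 1.
  by rewrite /q lerBlDr lerDl sumr_ge0// => k _; exact: sqr_ge0.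
have m0 : 0 <= Num.max q 0 by rewrite le_max lexx orbT.
have m1 : Num.max q 0 <= 1 by rewrite ge_max q1 ler01.
have m2 : 0 <= Num.max q 0 ^+ 2 <= 1 by rewrite exprn_ge0//= exprn_ile1.
have m3 : 0 <= Num.max q 0 ^+ 3 <= 1 by rewrite exprn_ge0//= exprn_ile1.
apply: (@c2_le_comp R n _ (fun t => Num.max t 0 ^+ 3) (fun t => 3 * Num.max t 0 ^+ 2)
  (3 * (2 * Num.max q 0 ^+ 1))) cq _ _ _ _ _ => //.
- by apply/nbhs_ballP; exists 1 => //= t _; exact: is_derive_max0X.
- have := is_derive_max0X 0 q => ?.
  exact: (@is_deriveZ _ _ _ _ 3 q 1 _ _).
- by rewrite ger0_norm -/q; lra.
- by rewrite ger0_norm -/q; lra.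
- by rewrite expr1 ger0_norm -/q; lra.
Qed.

End Bump.
Arguments bump_bound R n : clear implicits.
Arguments bump_quad_bound R n : clear implicits.

Lemma bump_bound_ge0 (R : realType) n : 0 <= bump_bound R n.
Proof.
have q0 : 0 <= bump_quad_bound R n.
  apply: addr_ge0; first exact: ler01.
  by do 3!(apply: mulr_ge0; first exact: ler0n); apply: mulr_ge0; exact: ler0n.
apply: mulr_ge0; first exact: ler0n.
by apply: addr_ge0; [apply: addr_ge0; [exact: ler01|]|exact: sqr_ge0].
Qed.

(** * Dyadic lattice points at a scale comparable to the distance *)

Definition whitney_index (n : nat) : choiceType := (int * {ffun 'I_n -> int})%type.

Section WhitneyIndices.
Context {R : realType} {n : nat}.
Implicit Types (j : int) (t : whitney_index n) (x y z : 'rV[R]_n).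

(** This is 2^j, written with [expR] so that negative exponents obey the same laws. *)
Definition dyadic j : R := expR (j%:~R * ln 2).

Lemma dyadic_gt0 j : 0 < dyadic j.
Proof. exact: expR_gt0. Qed.

Lemma dyadicD j k : dyadic (j + k) = dyadic j * dyadic k.
Proof. by rewrite /dyadic intrD mulrDl expRD. Qed.

Lemma dyadic1 : dyadic 1 = 2.
Proof. by rewrite /dyadic mul1r lnK// posrE. Qed.

Lemma ltr_dyadic j k : (dyadic j < dyadic k) = (j < k).
Proof. by rewrite /dyadic ltr_expR ltr_pM2r ?ltr_int// ln_gt0// ltr1n. Qed.

Lemma dyadic_scale (x : R) : 0 < x -> exists j, dyadic j <= x < 2 * dyadic j.
Proof.
move=> x0; have ln2 : 0 < ln (2 : R) by rewrite ln_gt0// ltr1n.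
exists (Num.floor (ln x / ln 2)).
have /andP[f1 f2] := floor_itv (ln x / ln 2).
have xE : expR (ln x) = x by rewrite lnK// posrE.
apply/andP; split.
  by rewrite -[leRHS]xE ler_expR -ler_pdivlMr.
by rewrite -[ltLHS]xE -[X in X * _]dyadic1 -dyadicD addrC ltr_expR -ltr_pdivrMr.
Qed.

(** The factor [n] makes the radius exceed the Euclidean diameter sqrt(n) 2^j of a lattice cell when
    n is at least 2, so that a bump is bounded below on the cells touching its centre. *)
Definition wrad t : R := n%:R * dyadic t.1.

Definition wcenter t : 'rV[R]_n := \row_i (dyadic t.1 * (t.2 i)%:~R).

(* The lattice cubes whose size is comparable to their distance to the boundary. *)
Definition whitney (delta : 'rV[R]_n -> R) t : bool :=
  3 * wrad t <= delta (wcenter t) <= 9 * wrad t.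

(** A set depending on [y] alone that contains every index whose bump is nonzero somewhere within
    [delta y / 2] of [y]; see [wbump_near]. *)
Definition near_whitney (delta : 'rV[R]_n -> R) y t : bool :=
  [&& whitney delta t, delta y / 20 <= wrad t <= delta y & `|y - wcenter t| <= 11 * wrad t].

(** Only five scales satisfy the size condition, and at each of them a lattice coordinate has at
    most [22 * n + 1] values. The count depends on [n] alone. *)
Lemma near_whitney_finite (delta : 'rV[R]_n -> R) y : (0 < n)%N -> 0 < delta y ->
  exists s : seq (whitney_index n),
  [/\ uniq s, (size s <= 5 * (22 * n).+1 ^ n)%N & s =i near_whitney delta y].
Proof.
move=> n0 d0; set d := delta y.
have nR : 0 < n%:R :> R by rewrite ltr0n.
have [j0 /andP[j0d dj0]] : exists j, dyadic j <= d / (4 * n%:R) < 2 * dyadic j.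
  by apply: dyadic_scale; rewrite divr_gt0// mulr_gt0.
rewrite ler_pdivlMr ?mulr_gt0// in j0d; rewrite ltr_pdivrMr ?mulr_gt0// in dj0.
(* The scales run from [j0 - 2] to [j0 + 2]; [fl j i] is the least admissible lattice coordinate. *)
pose jj (a : 'I_5) : int := j0 - 2 + (a : nat)%:Z.
pose fl j i : int := Num.floor (y 0 i / dyadic j) - (11 * n)%N%:Z.
pose F (ab : 'I_5 * {ffun 'I_n -> 'I_(22 * n).+1}) : whitney_index n :=
  (jj ab.1, [ffun i => fl (jj ab.1) i + (ab.2 i : nat)%:Z]).
exists [seq t <- undup [seq F ab | ab <- enum {: 'I_5 * {ffun 'I_n -> 'I_(22 * n).+1}}] |
  near_whitney delta y t]; split.
- by rewrite filter_uniq// undup_uniq.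
- rewrite size_filter; apply: (leq_trans (count_size _ _)).
  apply: (leq_trans (size_undup _)); rewrite size_map -cardE card_prod.
  by rewrite card_ffun !card_ord.
move=> t; rewrite mem_filter andb_idr// => /and3P[_ /andP[dr rd] ty].
rewrite mem_undup; case: t dr rd ty => j k; rewrite /wrad /= -/d => dr rd ty.
have jlt : j < j0 + 3%:Z.
  rewrite -ltr_dyadic (_ : j0 + 3%:Z = j0 + 1 + 1 + 1); last by rewrite -!addrA.
  rewrite !dyadicD dyadic1 -(ltr_pM2l nR); apply: (le_lt_trans rd); lra.
have jgt : j0 < j + 3%:Z.
  rewrite -ltr_dyadic (_ : j + 3%:Z = j + 1 + 1 + 1); last by rewrite -!addrA.
  rewrite !dyadicD dyadic1 -(ltr_pM2l nR).
  have := dyadic_gt0 j0; nra.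
pose a : 'I_5 := inord (absz (j - (j0 - 2))%R).
have aE : jj a = j by rewrite /jj inordK; lia.
pose b : {ffun 'I_n -> 'I_(22 * n).+1} := [ffun i => inord (absz (k i - fl j i)%R)].
apply/mapP; exists (a, b); first by rewrite mem_enum.
rewrite /F /= aE; congr (_, _); apply/ffunP => i; rewrite !ffunE.
have s0 := dyadic_gt0 j.
have : `|y 0 i / dyadic j - (k i)%:~R| <= 11 * n%:R.
  have := le_trans (coord_le_norm _ i) ty; rewrite !mxE => h.
  rewrite -(ler_pM2l s0) -{1}(gtr0_norm s0) -normrM mulrBr mulrCA divff ?gt_eqF// mulr1.
  by apply: (le_trans h); lra.
have /andP[f1 f2] := floor_itv (y 0 i / dyadic j).
rewrite ler_distl => /andP[k1 k2].
have h1 : Num.floor (y 0 i / dyadic j) - (11 * n)%N%:Z <= k i.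
  rewrite lerBlDr -(ler_int R) intrD; apply: (le_trans f1).
  by rewrite -pmulrn natrM; lra.
have h2 : k i < Num.floor (y 0 i / dyadic j) + 1 + (11 * n)%N%:Z.
  rewrite -(ltr_int R) intrD -[X in _ + X]pmulrn natrM; lra.
have h0 : 0 <= k i - fl j i by rewrite subr_ge0.
rewrite inordK; first by rewrite gez0_abs// addrC subrK.
rewrite -ltz_nat gez0_abs// (_ : (22 * n).+1 = 11 * n + 11 * n + 1)%N; last by rewrite addn1 -mulnDl.
rewrite !PoszD ltrBlDr /fl; apply: (lt_le_trans h2).
by rewrite le_eqVlt; apply/orP; left; apply/eqP; ring.
Qed.

End WhitneyIndices.

(** * The smoothed function and its derivative estimates *)

Section WhitneyExtension.
Context {R : realType} {n : nat} (delta : 'rV[R]_n -> R) (n1 : (1 < n)%N)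
  (deltaL : forall x y, delta x <= delta y + `|x - y|).
Implicit Types (t : whitney_index n) (x y z : 'rV[R]_n) (c : whitney_index n -> R).

Definition wbump t y : R := bump (wcenter t) (wrad t) y.

(** The sum is 0 by convention if infinitely many terms are nonzero; [wsum_finite] excludes this
    where [delta] is positive. *)
Definition wsum c y : R := \sum_(t \in [set t | whitney delta t]) wbump t y * c t.

Definition wext (g : 'rV[R]_n -> R) y : R :=
  wsum (fun t => g (wcenter t)) y / wsum (fun=> 1) y.

Lemma wrad_gt0 t : 0 < wrad t :> R.
Proof. by rewrite mulr_gt0 ?dyadic_gt0// ltr0n ltnW. Qed.

(** On the support [delta z] is between 2 and 10 radii, and it differs from [delta y] by at most
    [delta y / 2]. Hence [delta y] is at most 20 radii, the radius at most [delta y], and [y] within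
    10 + 1 radii of the centre. *)
Lemma wbump_near t y z : whitney delta t -> `|z - y| <= delta y / 2 ->
  wbump t z != 0 -> near_whitney delta y t.
Proof.
move=> wt zy /(bump_supp (wrad_gt0 t)) zp.
have d1 := deltaL z y; have d2 := deltaL y z.
have d3 := deltaL z (wcenter t); have d4 := deltaL (wcenter t) z.
have yp : `|y - wcenter t| <= `|z - y| + `|z - wcenter t|.
  by apply: (le_trans (ler_distD z _ _)); rewrite (distrC y z).
rewrite (distrC y z) in d2; rewrite (distrC (wcenter t) z) in d4.
have r0 := wrad_gt0 t; have /andP[w1 w2] := wt.
by apply/and3P; split => //; [apply/andP; split; lra|lra].
Qed.

(** One finite list serves for all [z] near [y], so the sum can be differentiated term by term at
    [y]. *)
Lemma wsum_finite y z c (s : seq (whitney_index n)) :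
  uniq s -> s =i near_whitney delta y -> `|z - y| <= delta y / 2 ->
  wsum c z = \sum_(t <- s) wbump t z * c t.
Proof.
move=> us sE zy; rewrite /wsum (@fsbigE _ _ _ _ _ s)//.
- rewrite big_seq_cond [RHS]big_seq; apply: eq_bigl => t.
  rewrite andb_idr// sE => /and3P[wt _ _].
  by rewrite mem_set.
- by move=> t /=; rewrite sE => /and3P[].
- move=> t /= wt; rewrite sE => nt.
  have [->|w0] := eqVneq (wbump t z) 0; first by rewrite mul0r.
  by rewrite -topredE /= (wbump_near wt zy w0) in nt.
Qed.

(** One bump suffices: at the scale whose radius is between [delta y / 8] and [delta y / 4], the
    lattice corner below [y] is within one radius of [y], so [delta] there is between 3 and 9 radii.
    This explains the thresholds of [whitney]. *)
Lemma wsum_ge y : 0 < delta y -> 1 / 8 <= wsum (fun=> 1) y.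
Proof.
move=> d0; have [s [us _ sE]] := near_whitney_finite (ltnW n1) d0.
rewrite (@wsum_finite y y _ s)//; last by rewrite subrr normr0; lra.
have nR : 2 <= n%:R :> R by rewrite ler_nat.
have n40 : 0 < 4 * n%:R :> R by lra.
have [j /andP[jd dj]] := dyadic_scale (divr_gt0 d0 n40).
rewrite ler_pdivlMr// in jd; rewrite ltr_pdivrMr// in dj.
have s0 := @dyadic_gt0 R j.
pose t : whitney_index n := (j, [ffun i => Num.floor (y 0 i / dyadic j)]).
have yt i : 0 <= y 0 i - wcenter t 0 i <= dyadic j.
  rewrite mxE ffunE /=; have /andP[f1 f2] := floor_itv (y 0 i / dyadic j).
  rewrite intrD in f2; move: f1 f2; rewrite ler_pdivlMr// ltr_pdivrMr// => f1 f2.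
  by apply/andP; split; rewrite mulrC; lra.
have rt : wrad t = n%:R * dyadic j :> R by [].
have ynt : `|y - wcenter t| <= wrad t.
  apply: row_norm_le => [|i]; first exact/ltW/wrad_gt0.
  have /andP[h1 h2] := yt i; rewrite !mxE in h1 h2 *; rewrite ger0_norm// rt; nra.
have d1 := deltaL y (wcenter t); have d2 := deltaL (wcenter t) y.
rewrite (distrC _ y) in d2.
have nt : t \in s.
  rewrite sE; apply/and3P; split; [|rewrite rt; lra|have := wrad_gt0 t; lra].
  by apply/andP; split; rewrite rt in ynt *; lra.
rewrite (bigD1_seq t)//= mulr1.
apply: (@le_trans _ _ (wbump t y)); last first.
  by rewrite lerDl sumr_ge0// => u _; rewrite mulr1 bump_ge0.
apply: bump_ge.
(* Each coordinate of [y - wcenter t] is at most 1 / n of the radius, so the sum of squares is at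
   most 1 / n, hence at most 1 / 2. *)
apply: (@le_trans _ _ (\sum_(k < n) (n%:R^-1) ^+ 2)).
  apply: ler_sum => k _; have /andP[h1 h2] := yt k.
  have nn : 0 < n%:R :> R by lra.
  rewrite lerXn2r ?nnegrE ?divr_ge0 ?invr_ge0 ?(ltW (wrad_gt0 _)) ?(ltW nn)//.
  by rewrite ler_pdivrMr ?wrad_gt0// rt mulrA mulVf ?gt_eqF// mul1r.
rewrite sumr_const card_ord -[leLHS]mulr_natl expr2 mulrA divff ?mul1r; last by rewrite gt_eqF//; lra.
by rewrite lef_pV2 ?posrE//; lra.
Qed.

Definition overlap_bound : R := (5 * (22 * n).+1 ^ n)%:R.

Lemma c2_le_wsum_finite y c (B : R) (s : seq (whitney_index n)) :
  0 < delta y -> (size s <= 5 * (22 * n).+1 ^ n)%N -> s =i near_whitney delta y ->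
  0 <= B -> {in s, forall t, `|c t| <= B} ->
  c2_le (fun z => \sum_(t <- s) wbump t z * c t) y
    (overlap_bound * (4 * (bump_bound R n * B))) (delta y).
Proof.
move=> d0 ss sE B0 cB.
have bb0 := bump_bound_ge0 R n.
have c4 : 0 <= 4 * (bump_bound R n * B) by rewrite mulr_ge0// mulr_ge0.
apply: (@c2_le_mono _ _ _ _ (\sum_(t <- s) 4 * (bump_bound R n * B))) => //.
  rewrite big_const_seq count_predT iter_addr_0 -[leLHS]mulr_natl.
  by rewrite ler_wpM2r// ler_nat.
apply: c2_le_sum => // t ts.
have := ts; rewrite sE => /and3P[wt /andP[rt1 rt2] rt3].
apply: c2_le_mono (c2_leM d0 (c2_le_bump d0 rt1 rt2 rt3) (c2_le_cst (c t) y d0)) => //.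
by rewrite ler_wpM2l// ler_wpM2l// cB.
Qed.

(** [M] is the size of the denominator; 11 n comes from |g(p) - g(y)| being at most 11 n L delta(y);
    and 1024 = 2 * 8^3 bounds 1/u, 1/u^2 and 2/u^3 for u at least 1/8. *)
Definition whitney_const : R :=
  let M := overlap_bound * (4 * (bump_bound R n * 1)) in
  4 * (overlap_bound * (4 * (bump_bound R n * (11 * n%:R))) * (1024 * (1 + M + M ^+ 2))).

(** The bumps divided by their sum [W] add up to 1, so the difference is [F / W], where the
    coefficients g(p) - g(y) of [F] are of order L delta(y). The denominator is at least 1/8 and of
    bounded size at scale delta(y). *)
Lemma c2_le_wext (g : 'rV[R]_n -> R) (L : R) y :
  0 <= L -> (forall x z, `|g x - g z| <= L * \sum_i `|x 0 i - z 0 i|) -> 0 < delta y ->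
  c2_le (fun z => wext g z - g y) y (whitney_const * (L * delta y)) (delta y).
Proof.
move=> L0 gL d0; have [s [us ss sE]] := near_whitney_finite (ltnW n1) d0.
pose F z := \sum_(t <- s) wbump t z * (g (wcenter t) - g y).
pose W z := \sum_(t <- s) wbump t z * 1.
have W8 z : `|z - y| <= delta y / 2 -> 1 / 8 <= W z.
  move=> zy; rewrite /W -(wsum_finite (fun=> 1) us sE zy); apply: wsum_ge.
  have := deltaL y z; rewrite distrC; lra.
have Wy : 1 / 8 <= W y by apply: W8; rewrite subrr normr0; lra.
have cF : c2_le F y (overlap_bound * (4 * (bump_bound R n * (11 * n%:R * (L * delta y))))) (delta y).
  apply: c2_le_wsum_finite => //.
    by rewrite mulr_ge0// mulr_ge0// ltW.
  move=> t; rewrite sE => /and3P[_ /andP[_ rd] yp].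
  apply: (le_trans (gL _ _)); rewrite mulrCA ler_wpM2l//.
  apply: (@le_trans _ _ (\sum_(i < n) 11 * delta y)).
    apply: ler_sum => i _; rewrite distrC.
    have := coord_le_norm (y - wcenter t) i; rewrite !mxE; lra.
  by rewrite sumr_const card_ord -[leLHS]mulr_natl mulrA [_ * 11]mulrC.
have cW : c2_le W y (overlap_bound * (4 * (bump_bound R n * 1))) (delta y).
  by apply: c2_le_wsum_finite => // t _; rewrite normr1.
have W0 : W y != 0 by rewrite gt_eqF//; lra.
have Vy : 0 <= (W y)^-1 <= 8.
  rewrite invr_ge0 (_ : 8 = (1 / 8)^-1) ?lef_pV2 ?posrE//; last by field.
  by rewrite Wy andbT; lra.
  by lra.
have V2 : 0 <= (W y)^-1 ^+ 2 <= 8 ^+ 2 by rewrite exprn_ge0 ?lerXn2r ?nnegrE//; lra.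
have V3 : 0 <= (W y)^-1 ^+ 3 <= 8 ^+ 3 by rewrite exprn_ge0 ?lerXn2r ?nnegrE//; lra.
have cV := @c2_le_comp R n W (fun u : R => u^-1) (fun u : R => - u ^- 2) (2 * W y ^- 3) 1024 y _ _ d0 cW.
apply: (@near_eq_c2_le _ _ (F \* ((fun u : R => u^-1) \o W))); last first.
  have -> : whitney_const * (L * delta y) =
    4 * (overlap_bound * (4 * (bump_bound R n * (11 * n%:R * (L * delta y)))) *
      (1024 * (1 + overlap_bound * (4 * (bump_bound R n * 1))
        + (overlap_bound * (4 * (bump_bound R n * 1))) ^+ 2))).
    by rewrite /whitney_const; ring.
  apply: (c2_leM d0 cF); apply: cV.
  (* Since [W y] is at least 1 / 8, every [u] at distance less than 1 / 8 from it is positive. *)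
  - apply/nbhs_ballP; exists (1 / 8); first by rewrite /=; lra.
    move=> u; rewrite /ball /= ltr_distlC => /andP[u1 _].
    by apply: is_derive_inv; rewrite gt_eqF//; lra.
  - exact: is_derive_invX2.
  - by rewrite ger0_norm; lra.
  - by rewrite normrN -exprVn ger0_norm; lra.
  - by rewrite -exprVn ger0_norm; lra.
(* The quotient formula holds on the ball where the finite list computes both sums. *)
apply/nbhs_ballP; exists (delta y / 2); first by rewrite /=; lra.
move=> z; rewrite -ball_normE /= distrC => /ltW zy.
have Wz : W z != 0 by have := W8 _ zy => h; rewrite gt_eqF//; lra.
rewrite /wext !(wsum_finite _ us sE zy) -/(W z).
rewrite -[X in _ = _ - X](mulfK Wz) -mulrBl; congr (_ / _).
rewrite /F /W mulr_sumr -sumrB; apply: eq_bigr => t _; ring.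
Qed.

End WhitneyExtension.
Arguments whitney_const R n : clear implicits.

(** * Comparison of the Euclidean and sup-norm distances *)

Section SupDistance.
Context {R : realType} {n : nat} (A : set 'rV[R]_n) (A0 : A !=set0).
Implicit Types x y : 'rV[R]_n.

(* The Euclidean [dist] is replaced by the distance in the sup norm of the
   library, which is equivalent to it. *)
Definition sdist y : R := inf [set `|y - s| | s in A].

Let has_lb y : has_lbound [set `|y - s| | s in A].
Proof. by exists 0 => _ [s _ <-]. Qed.

Let img_neq0 y : [set `|y - s| | s in A] !=set0.
Proof. by have [a Aa] := A0; exists `|y - a|, a. Qed.

Lemma sdist_le y s : A s -> sdist y <= `|y - s|.
Proof. by move=> As; apply: ge_inf => //; exists s. Qed.

Lemma le_sdist y (r : R) : (forall s, A s -> r <= `|y - s|) -> r <= sdist y.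
Proof. by move=> h; apply: lb_le_inf => // _ [s As <-]; exact: h. Qed.

Lemma sdist_lip x y : sdist x <= sdist y + `|x - y|.
Proof.
rewrite -lerBlDr; apply: le_sdist => s As; rewrite lerBlDr.
by rewrite addrC (le_trans (sdist_le x As))// ler_distD.
Qed.

Lemma sdist_le_dist y : sdist y <= dist y A.
Proof.
apply: lb_le_inf; first by have [a Aa] := A0; exists (enorm (y - a)), a.
move=> _ [s As <-]; apply: (le_trans (sdist_le y As)).
apply: row_norm_le; first exact: sqrtr_ge0.
by move=> i; exact: coord_le_enorm.
Qed.

(** For the Hessian bound, where the distance stands in the denominator. *)
Lemma dist_le_sdist y : (0 < n)%N -> dist y A <= n%:R * sdist y.
Proof.
move=> n0; rewrite -ler_pdivrMl ?ltr0n//; apply: le_sdist => s As.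
rewrite ler_pdivrMl ?ltr0n//.
have -> : n%:R * `|y - s| = (1 * n)%:R * `|y - s| by rewrite mul1n.
apply: (@le_trans _ _ (enorm (y - s))).
  by apply: ge_inf; [exists 0 => _ [u _ <-]; exact: sqrtr_ge0|exists s].
by apply: enorm_le_entry => i j; rewrite ord1; exact: coord_le_norm.
Qed.

End SupDistance.

(** * The straightened coordinates and their C^{1,1} regularity *)

Lemma lip1_continuous (R : realType) n (delta : 'rV[R]_n -> R) :
  (forall x y, delta x <= delta y + `|x - y|) -> continuous delta.
Proof.
move=> deltaL x; apply/(@cvgrPdist_le _ _ _ _ (nbhs_filter x)) => e e0; apply/nbhs_ballP; exists e => //= y.
rewrite -ball_normE /= => /ltW xy; apply: le_trans xy.
have h1 := deltaL x y; have h2 := deltaL y x.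
rewrite (distrC y x) in h2.
by rewrite ler_distlC; apply/andP; split; lra.
Qed.

Lemma derive_sum_pd (R : realType) n (f : 'rV[R]_n -> R) x (v : 'rV[R]_n) :
  differentiable f x -> 'D_v f x = \sum_i v 0 i * pd i f x.
Proof.
move=> df; rewrite deriveE// [in LHS](row_sum_delta v) linear_sum.
by apply: eq_bigr => i _; rewrite linearZ /= /pd deriveE.
Qed.

Lemma is_derive_line (R : realType) n (f : 'rV[R]_n -> R) (x v : 'rV[R]_n) (t : R) :
  differentiable f (x + t *: v) ->
  is_derive t (1 : R) (fun u : R => f (x + u *: v)) ('D_v f (x + t *: v)).
Proof.
move=> df; have dfv : derivable f (x + t *: v) v by exact: diff_derivable.
have E : (fun h : R => h^-1 *: ((f \o shift (x + t *: v)) (h *: v) - f (x + t *: v))) =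
    (fun h : R => h^-1 *: (((fun u => f (x + u *: v)) \o shift t) (h *: 1) - f (x + t *: v))).
  apply/funext => h /=; rewrite [h *: 1]mulr1; congr (_ *: (f _ - _)).
  by rewrite scalerDl addrCA.
by apply: DeriveDef; rewrite /derivable /derive -E.
Qed.

(** Mean value theorem along the segment; the factor [n] comes from summing over the partial
    derivatives. *)
Lemma segment_lipschitz (R : realType) n (f : 'rV[R]_n -> R) (x y : 'rV[R]_n) (B : R) :
  (forall t : R, 0 <= t <= 1 -> differentiable f (y + t *: (x - y)) /\
    forall i, `|pd i f (y + t *: (x - y))| <= B) ->
  `|f x - f y| <= n%:R * B * `|x - y|.
Proof.
move=> H; pose v : 'rV[R]_n := x - y.
have D (t : R) : 0 <= t <= 1 ->
    is_derive t (1 : R) (fun u : R => f (y + u *: v)) ('D_v f (y + t *: v)).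
  by move=> t01; apply: is_derive_line; have [] := H t t01.
have [t] : exists2 t : R, t \in `[0, 1]%R &
    f (y + 1 *: v) - f (y + 0 *: v) = 'D_v f (y + t *: v) * (1 - 0).
  apply: (@MVT_segment _ (fun u : R => f (y + u *: v)) (fun t : R => 'D_v f (y + t *: v))) => //.
    by move=> u; rewrite in_itv /= => /andP[u0 u1]; apply: D; rewrite !ltW.
  apply: derivable_within_continuous => u; rewrite in_itv /= => u01.
  by have [] := D u u01.
rewrite in_itv /= subr0 mulr1 scale1r scale0r addr0 [y + v]addrC subrK => t01 ->.
have [df pf] := H t t01; rewrite derive_sum_pd//.
apply: (le_trans (ler_norm_sum _ _ _)).
apply: (@le_trans _ _ (\sum_(i < n) B * `|x - y|)).
  apply: ler_sum => i _; rewrite normrM mulrC.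
  exact: (ler_pM (normr_ge0 _) (normr_ge0 _) (pf i) (coord_le_norm v i)).
by rewrite sumr_const card_ord -[leLHS]mulr_natl mulrA.
Qed.

Section StraightenedCoordinate.
Context {R : realType} {n : nat} (delta : 'rV[R]_n -> R) (n1 : (1 < n)%N)
  (deltaL : forall x y, delta x <= delta y + `|x - y|).
Context (g : 'rV[R]_n -> R) (L : R) (k : 'I_n) (L0 : 0 <= L)
  (gL : forall x z, `|g x - g z| <= L * \sum_i `|x 0 i - z 0 i|).
Implicit Types x y : 'rV[R]_n.

Definition straight y : R := y 0 k - wext delta g y.

Let C := whitney_const R n.

(** This records regularity; the sharp estimates follow from [c2_le_wext] through [pd_straight]. *)
Lemma straight_c2 y : 0 < delta y -> exists M, c2_le straight y M (delta y).
Proof.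
move=> d0; have cf := c2_le_wext n1 deltaL L0 gL d0.
pose M := delta y + `|y 0 k - g y|.
have ck : c2_le (fun z => z 0 k - g y) y M (delta y).
  by apply: c2_le_coord => //; rewrite /M ?lerDr ?lerDl// ltW.
have := c2_leD ck (c2_leM d0 (c2_le_cst (-1) y d0) cf).
set N := (M + _); move=> h; exists N; move: h.
by congr c2_le; apply/funext => z /=; rewrite /straight; ring.
Qed.

(** Subtracting the constant [g y] leaves the derivatives unchanged and brings them under the
    control of [c2_le_wext] at [y]. *)
Lemma pd_straight y i : 0 < delta y ->
  {near y, (fun z => (k == i)%:R - pd i (fun u => wext delta g u - g y) z) =1 pd i straight}.
Proof.
move=> d0; have [df _ _ _ _] := c2_le_wext n1 deltaL L0 gL d0.
apply: filterS df => z dfz.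
have dk : derivable (fun u : 'rV[R]_n => u 0 k - g y) z (delta_mx 0 i).
  apply: diff_derivable; apply: differentiableB; last exact: differentiable_cst.
  exact: differentiable_coord.
have -> : straight = (fun u : 'rV[R]_n => u 0 k - g y) - (fun u : 'rV[R]_n => wext delta g u - g y).
  by apply/funext => u; rewrite /straight !fctE; ring.
rewrite {2}/pd deriveB; [|exact: dk|exact: diff_derivable].
by rewrite -!/(pd _ _ _) pd_coord.
Qed.

Lemma straight_value y : 0 < delta y ->
  `|straight y - (y 0 k - g y)| <= C * (L * delta y).
Proof.
move=> d0; have [_ _ h _ _] := c2_le_wext n1 deltaL L0 gL d0.
have -> : straight y - (y 0 k - g y) = - (wext delta g y - g y).
  by rewrite /straight; ring.
by rewrite normrN.
Qed.

Lemma straight_grad y i : 0 < delta y -> `|pd i straight y - (k == i)%:R| <= C * L.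
Proof.
move=> d0; have [_ _ _ h _] := c2_le_wext n1 deltaL L0 gL d0.
rewrite -(nbhs_singleton (pd_straight i d0)) addrAC subrr add0r normrN.
by apply: (le_trans (h i)); rewrite mulrA mulfK// gt_eqF.
Qed.

Lemma straight_hess y i j : 0 < delta y -> `|pd j (pd i straight) y| <= C * (L / delta y).
Proof.
move=> d0; have [_ dd _ _ h] := c2_le_wext n1 deltaL L0 gL d0.
rewrite {1}/pd -(near_eq_derive _ (pd_straight i d0)).
rewrite deriveB; [|exact: derivable_cst|exact: diff_derivable].
rewrite derive_cst sub0r normrN; apply: (le_trans (h i j)).
rewrite le_eqVlt; apply/orP; left; apply/eqP; rewrite -/C.
by field; rewrite gt_eqF.
Qed.

(** On [K] the function [delta] has a positive minimum. Pairs closer than half of it are joined by a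
    segment where [delta] is at least that half, so the Hessian bound applies even if the segment
    leaves [K]. For the other pairs the gradient bound suffices. *)
Lemma straight_C11 (U : set 'rV[R]_n) : (forall y, U y -> 0 < delta y) ->
  C11_loc U straight.
Proof.
move=> Upos; split=> [y Uy|K cK KU].
  by have [M [h _ _ _ _]] := straight_c2 (Upos y Uy); exact: nbhs_singleton h.
have [->|/set0P K0] := eqVneq K set0; first exact: lipschitz_set0.
have [c] := EVT_min_rV K0 cK (continuous_subspaceT (lip1_continuous deltaL)).
rewrite inE => Kc cmin.
have d0 : 0 < delta c := Upos _ (KU _ Kc).
pose E := C * L / delta c.
have CLE : C * L = E * delta c by rewrite /E divfK// gt_eqF.
have CL0 : 0 <= C * L := le_trans (normr_ge0 _) (straight_grad k d0).
have E0 : 0 <= E by rewrite divr_ge0// ltW.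
have PF : ProperFilter (globally (K `*` K)) by exact: (@globally_properfilter _ _ (c, c)).
(* Distant pairs cost 4 E, since 2 C L = 2 E delta(c); close pairs cost [n] times the Hessian bound
   2 E. *)
apply: (@klipschitzW _ _ _ ((4 + 2 * n%:R) * E)) => -[x y] /= [Kx Ky].
have nE : 0 <= n%:R * E * `|x - y| by rewrite mulr_ge0// mulr_ge0.
have E1 : 0 <= E * `|x - y| by rewrite mulr_ge0.
apply: row_norm_le => [|i]; first by lra.
rewrite !mxE -!/(pd _ _ _).
have dx : delta c <= delta x by apply: cmin; rewrite inE.
have dy : delta c <= delta y by apply: cmin; rewrite inE.
have [xy|xy] := ltP `|x - y| (delta c / 2); last first.
  have gx := straight_grad i (lt_le_trans d0 dx).
  have gy := straight_grad i (lt_le_trans d0 dy).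
  apply: (le_trans (ler_distD (k == i)%:R _ _)).
  rewrite (distrC _ (pd _ _ y)); apply: (le_trans (lerD gx gy)).
  have := ler_wpM2l E0 xy; rewrite CLE; lra.
apply: (le_trans (@segment_lipschitz _ _ (pd i straight) x y (2 * E) _)).
  move=> t /andP[t0 t1].
  have dz : delta c / 2 <= delta (y + t *: (x - y)).
    have := deltaL y (y + t *: (x - y)); rewrite opprD addNKr normrN normrZ ger0_norm//.
    have : t * `|x - y| <= `|x - y| by rewrite ler_piMl.
    lra.
  have z0 : 0 < delta (y + t *: (x - y)) by lra.
  split; first by have [M []] := straight_c2 z0.
  move=> j; apply: (le_trans (straight_hess i j z0)).
  rewrite mulrA ler_pdivrMr// CLE.
  by have := ler_wpM2l E0 dz; lra.
lra.
Qed.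

End StraightenedCoordinate.

(** * The slit domain *)

Lemma sum_lift_max (R : realType) k (F : 'I_k.+1 -> R) :
  \sum_i F i = \sum_(i < k) F (lift ord_max i) + F ord_max.
Proof.
rewrite big_ord_recr /=; congr (_ + _); apply: eq_bigr => i _; congr F.
by apply: val_inj; exact/esym/lift_max.
Qed.

Lemma ae_in_everywhere (R : realType) n (D : set 'rV[R]_n) (P : 'rV[R]_n -> Prop) :
  (forall x, D x -> P x) -> ae_in D P.
Proof.
move=> DP e e0; exists set0, (fun=> 0), (fun=> 0); split => //.
- by move=> x [Dx nP]; exfalso; exact/nP/DP.
- by rewrite esum_set0 lee_fin ltW.
Qed.

Section SlitGeometry.
Context {R : realType} {m : nat}.
Implicit Types (x y z : 'rV[R]_m.+2).

Lemma snoc_lift k (v : 'rV[R]_k) (t : R) i : snoc v t 0 (lift ord_max i) = v 0 i.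
Proof. by rewrite mxE liftK. Qed.

Lemma snoc_max k (v : 'rV[R]_k) (t : R) : snoc v t 0 ord_max = t.
Proof. by rewrite mxE unlift_none. Qed.

Lemma pr1_snoc (v : 'rV[R]_m.+1) (t : R) : pr1 (snoc v t) = v.
Proof. by apply/rowP => i; rewrite mxE snoc_lift. Qed.

Lemma pr2_snoc (v : 'rV[R]_m) (t u : R) : pr2 (snoc (snoc v t) u) = v.
Proof. by rewrite /pr2 pr1_snoc; apply/rowP => i; rewrite mxE snoc_lift. Qed.

Context (gamma : 'rV[R]_m -> R) (Gamma : 'rV[R]_m.+1 -> R) (L : R)
  (data : slit_data gamma Gamma L).

Let Sl := slit gamma Gamma.

Lemma slit_L_ge0 : 0 <= L.
Proof. by have [_ /lipschitz_grad_le_ge0] := data. Qed.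

Lemma Gamma_lip x y :
  `|Gamma (pr1 x) - Gamma (pr1 y)| <= L * \sum_i `|x 0 i - y 0 i|.
Proof.
have [_ /lipschitz_grad_le_sum GL _ _] := data.
apply: (le_trans (GL _ _)); rewrite ler_wpM2l ?slit_L_ge0// [leRHS]sum_lift_max.
rewrite -[leLHS]addr0 lerD//; apply: ler_sum => i _.
by rewrite !mxE.
Qed.

Lemma gamma_lip x y :
  `|gamma (pr2 x) - gamma (pr2 y)| <= L * \sum_i `|x 0 i - y 0 i|.
Proof.
have [/lipschitz_grad_le_sum gL _ _ _] := data.
apply: (le_trans (gL _ _)); rewrite ler_wpM2l ?slit_L_ge0// [leRHS]sum_lift_max.
rewrite -[leLHS]addr0 lerD// [leRHS]sum_lift_max -[leLHS]addr0 lerD//; apply: ler_sum => i _.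
by rewrite !mxE.
Qed.

(** The normalization puts the origin on the slit. *)
Lemma slit_neq0 : Sl !=set0.
Proof.
have [_ _ g0 G0] := data; exists 0; rewrite /Sl /slit /=.
have -> : pr1 (0 : 'rV[R]_m.+2) = 0 by apply/rowP => i; rewrite !mxE.
have -> : pr2 (0 : 'rV[R]_m.+2) = 0 by apply/rowP => i; rewrite !mxE.
by rewrite g0 G0 !mxE.
Qed.

Lemma sum_le_norm x : \sum_i `|x 0 i| <= m.+2%:R * `|x|.
Proof.
apply: (@le_trans _ _ (\sum_(i < m.+2) `|x|)).
  by apply: ler_sum => i _; exact: coord_le_norm.
by rewrite sumr_const card_ord -[leLHS]mulr_natl.
Qed.

(** Off the slit either y_n differs from Gamma(y') or y_(n-1) exceeds gamma(y''). This defect is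
    Lipschitz with constant [K] and disappears on the slit, so the distance is at least the defect
    divided by [K]. *)
Lemma sdist_slit_gt0 y : (~` Sl) y -> 0 < sdist Sl y.
Proof.
move=> ny; have L0 := slit_L_ge0.
pose K := 1 + L * m.+2%:R.
have K0 : 0 < K by rewrite ltr_pwDl// mulr_ge0.
have bound (g : 'rV[R]_m.+2 -> R) (s : 'rV[R]_m.+2) (i : 'I_m.+2) :
    (forall x z, `|g x - g z| <= L * \sum_i `|x 0 i - z 0 i|) ->
    `|y 0 i - s 0 i| + `|g s - g y| <= K * `|y - s|.
  move=> gL; rewrite mulrDl mul1r lerD//.
    by have := coord_le_norm (y - s) i; rewrite !mxE.
  rewrite distrC; apply: (le_trans (gL _ _)); rewrite -mulrA ler_wpM2l//.
  apply: le_trans (sum_le_norm _); apply: ler_sum => j _.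
  by rewrite !mxE.
have [yG|yG] := eqVneq (y 0 idx_n) (Gamma (pr1 y)).
  have yg : gamma (pr2 y) < y 0 idx_n1.
    by rewrite ltNge; apply/negP => h; apply: ny.
  apply: (@lt_le_trans _ _ ((y 0 idx_n1 - gamma (pr2 y)) / K)).
    by rewrite divr_gt0// subr_gt0.
  apply: (le_sdist slit_neq0) => s [s1 _]; rewrite ler_pdivrMr// mulrC.
  apply: le_trans (bound (fun x => gamma (pr2 x)) s idx_n1 gamma_lip).
  have := ler_norm (y 0 idx_n1 - s 0 idx_n1).
  have := ler_norm (gamma (pr2 s) - gamma (pr2 y)); lra.
apply: (@lt_le_trans _ _ (`|y 0 idx_n - Gamma (pr1 y)| / K)).
  by rewrite divr_gt0// normr_gt0 subr_eq0.
apply: (le_sdist slit_neq0) => s [_ s2]; rewrite ler_pdivrMr// mulrC.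
apply: le_trans (bound (fun x => Gamma (pr1 x)) s idx_n Gamma_lip).
by rewrite s2 ler_distD.
Qed.

(* The point of the slit obtained from [y] by moving its last two coordinates. *)
Lemma sdist_slit_le y (A : R) : `|y 0 idx_n - Gamma (pr1 y)| <= A ->
  y 0 idx_n1 - gamma (pr2 y) <= A -> sdist Sl y <= (1 + L) * A.
Proof.
move=> yG yg; have L0 := slit_L_ge0.
have A0 : 0 <= A := le_trans (normr_ge0 _) yG.
(* The coordinate y_(n-1) is lowered only if it exceeds gamma(y''). *)
pose t := Num.min (y 0 idx_n1) (gamma (pr2 y)).
have yt : `|y 0 idx_n1 - t| <= A.
  have [h|h] := leP (y 0 idx_n1) (gamma (pr2 y)).
    by rewrite /t min_l// subrr normr0.
  by rewrite /t min_r ?(ltW h)// ger0_norm// subr_ge0 ltW.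
pose w := snoc (pr2 y) t.
pose z := snoc w (Gamma w).
have Sz : Sl z.
  rewrite /Sl /slit /= /z pr2_snoc pr1_snoc snoc_max snoc_lift /w snoc_max.
  by split => //; rewrite ge_min lexx orbT.
apply: (le_trans (sdist_le y Sz)); apply: row_norm_le => [|i].
  by rewrite mulr_ge0// addr_ge0.
have LA : 0 <= L * A by rewrite mulr_ge0.
rewrite !mxE; case: unliftP => [i1 ->|->] /=.
  rewrite mxE; case: unliftP => [i2 ->|->] /=.
    by rewrite !mxE subrr normr0; lra.
  by move: yt; rewrite /idx_n1; lra.
(* Lowering y_(n-1) by at most [A] changes [Gamma] by at most [L * A]. *)
apply: (le_trans (ler_distD (Gamma (pr1 y)) _ _)).
rewrite mulrDl mul1r lerD//.
have [_ /lipschitz_grad_le_sum GL _ _] := data.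
apply: (le_trans (GL _ _)); rewrite ler_wpM2l// sum_lift_max big1 ?add0r.
  by rewrite /w snoc_max; rewrite mxE.
by move=> i1 _; rewrite /w snoc_lift !mxE subrr normr0.
Qed.

End SlitGeometry.

(* The ambient dimension is n = m.+2. *)
Theorem theorem1p17 (R : realType) (m : nat) :
  exists L0 C : R, 0 < L0 /\ 0 < C /\
  forall (gamma : 'rV[R]_m -> R) (Gamma : 'rV[R]_m.+1 -> R) (L : R),
  slit_data gamma Gamma L -> L <= L0 ->
  let Sl := slit gamma Gamma in
  let Omega := ~` Sl in
  exists zeta1 zeta2 : 'rV[R]_m.+2 -> R,
  let Phi := fun y => snoc (snoc (pr2 y) (zeta1 y)) (zeta2 y) in
  [/\ C11_loc Omega zeta1 /\ C11_loc Omega zeta2,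
      forall y, Omega y -> (~` model_slit) (Phi y),
      forall y, Omega y ->
        `|zeta1 y - (y 0 idx_n1 - gamma (pr2 y))|
        + `|zeta2 y - (y 0 idx_n - Gamma (pr1 y))| <= C * L * dist y Sl,
      forall y, Omega y ->
        enorm (grad zeta1 y - delta_mx 0 idx_n1)
        + enorm (grad zeta2 y - delta_mx 0 idx_n) <= C * L &
      ae_in Omega (fun y =>
        [/\ differentiable (grad zeta1) y, differentiable (grad zeta2) y &
            enorm (hess zeta1 y) + enorm (hess zeta2 y)
            <= C * (L / dist y Sl)])].
Proof.
pose n := m.+2; pose nR : R := n%:R.
pose C0 : R := `|whitney_const R n|.
have C00 : 0 <= C0 by exact: normr_ge0.
have n_ge1 : 1 <= nR by rewrite ler1n.
(* Two functions, a factor n^2 from Hessian entries to [enorm], and a factor n from [sdist] to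
   [dist]; the summand 1 makes [C] positive. *)
pose C := 2 * nR ^+ 3 * C0 + 1.
have nC1 : C0 <= nR * C0 by rewrite ler_peMl.
have nC2 : nR * C0 <= nR * (nR * C0) by rewrite ler_peMl// mulr_ge0//; lra.
have nC3 : nR * (nR * C0) <= nR * (nR * (nR * C0)).
  by rewrite ler_peMl// mulr_ge0 ?mulr_ge0//; lra.
have CE : C = 2 * (nR * (nR * (nR * C0))) + 1 by rewrite /C; ring.
have hess_arith (X Y : R) : 0 <= Y -> X <= nR * Y ->
    nR * (nR * (C0 * X)) + nR * (nR * (C0 * X)) <= C * Y.
  move=> Y0 XY; have n0 : 0 <= nR by exact: ler0n.
  have T := ler_wpM2l n0 (ler_wpM2l n0 (ler_wpM2l C00 XY)).
  apply: (le_trans (lerD T T)).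
  have -> : C * Y = nR * (nR * (C0 * (nR * Y))) + nR * (nR * (C0 * (nR * Y))) + Y.
    by rewrite CE; ring.
  by rewrite lerDl.
have C_gt0 : 0 < C by lra.
exists (6 * C)^-1, C; split; first by rewrite invr_gt0; lra.
split => // gamma Gamma L data LL0 Sl Omega.
have L0 : 0 <= L := slit_L_ge0 data.
have LC : L * (6 * C) <= 1 by rewrite -ler_pdivlMr ?mul1r//; lra.
have S0 : Sl !=set0 := slit_neq0 data.
have n1 : (1 < n)%N by [].
have dlip := sdist_lip S0.
have dpos : forall y, Omega y -> 0 < sdist Sl y := sdist_slit_gt0 data.
pose g1 (y : 'rV[R]_n) := gamma (pr2 y); pose g2 (y : 'rV[R]_n) := Gamma (pr1 y).
have g1L : forall x z, `|g1 x - g1 z| <= L * \sum_i `|x 0 i - z 0 i| := gamma_lip data.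
have g2L : forall x z, `|g2 x - g2 z| <= L * \sum_i `|x 0 i - z 0 i| := Gamma_lip data.
pose zeta1 := straight (sdist Sl) g1 idx_n1.
pose zeta2 := straight (sdist Sl) g2 idx_n.
have wC (a : R) : 0 <= a -> whitney_const R n * a <= C0 * a.
  by move=> a0; rewrite ler_wpM2r// ler_norm.
have val1 y : Omega y -> `|zeta1 y - (y 0 idx_n1 - g1 y)| <= C0 * (L * sdist Sl y).
  move=> Oy; apply: le_trans (wC _ _); last by rewrite mulr_ge0// ltW// dpos.
  exact: (straight_value n1 dlip idx_n1 L0 g1L (dpos _ Oy)).
have val2 y : Omega y -> `|zeta2 y - (y 0 idx_n - g2 y)| <= C0 * (L * sdist Sl y).
  move=> Oy; apply: le_trans (wC _ _); last by rewrite mulr_ge0// ltW// dpos.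
  exact: (straight_value n1 dlip idx_n L0 g2L (dpos _ Oy)).
have grad_le (g : 'rV[R]_n -> R) k y :
    (forall x z, `|g x - g z| <= L * \sum_i `|x 0 i - z 0 i|) -> Omega y ->
    enorm (grad (straight (sdist Sl) g k) y - delta_mx 0 k) <= nR * (C0 * L).
  move=> gL Oy; rewrite /nR -[n]mul1n; apply: enorm_le_entry => i j.
  rewrite !mxE ord1 eqxx /= eq_sym; apply: le_trans (wC _ L0).
  exact: (straight_grad n1 dlip k L0 gL j (dpos _ Oy)).
have hess_le (g : 'rV[R]_n -> R) k y :
    (forall x z, `|g x - g z| <= L * \sum_i `|x 0 i - z 0 i|) -> Omega y ->
    differentiable (grad (straight (sdist Sl) g k)) y /\
    enorm (hess (straight (sdist Sl) g k) y) <= nR * (nR * (C0 * (L / sdist Sl y))).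
  move=> gL Oy; have d0 := dpos _ Oy.
  have [M cM] := straight_c2 n1 dlip k L0 gL d0.
  split; first exact: differentiable_grad cM.
  rewrite mulrA /nR -natrM; apply: enorm_le_entry => i j.
  rewrite (hessE _ _ cM); apply: le_trans (wC _ _); last by rewrite divr_ge0// ltW.
  exact: (straight_hess n1 dlip k L0 gL j i d0).
exists zeta1, zeta2 => Phi; split.
- by split; [exact: (straight_C11 n1 dlip idx_n1 L0 g1L dpos)
            |exact: (straight_C11 n1 dlip idx_n L0 g2L dpos)].
(* If [Phi y] were in the model slit, y_n - Gamma(y') in absolute value and y_(n-1) - gamma(y'')
   would be at most [B], itself at most a sixth of [sdist Sl y] by the choice of L0. Then
   [sdist_slit_le] bounds this positive distance by a third of itself. *)
- move=> y Oy; rewrite /model_slit /Phi /= snoc_max snoc_lift snoc_max => -[z1 z2].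
  have d0 := dpos _ Oy; have v1 := val1 _ Oy; have v2 := val2 _ Oy.
  rewrite z2 sub0r opprB distrC in v2.
  set B := C0 * (L * sdist Sl y) in v1 v2.
  have yg : y 0 idx_n1 - gamma (pr2 y) <= B.
    by move: v1; rewrite ler_distl /g1 => /andP[v1 _]; lra.
  have C0C : C0 <= C by lra.
  have LleLC : L <= L * C by rewrite ler_peMr//; lra.
  have Ld : 0 <= L * sdist Sl y by rewrite mulr_ge0// ltW.
  have B0 : 0 <= B by rewrite mulr_ge0.
  have B6 : B <= sdist Sl y / 6.
    apply: (le_trans (ler_wpM2r Ld C0C)).
    by have := ler_wpM2r (ltW d0) LC; lra.
  have L1 : 1 + L <= 2 by lra.
  have := sdist_slit_le data v2 yg; have := ler_wpM2r B0 L1.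
  rewrite -/Sl; lra.
- move=> y Oy; apply: (le_trans (lerD (val1 _ Oy) (val2 _ Oy))).
  have dd := sdist_le_dist S0 y; have d0 := dpos _ Oy.
  apply: (@le_trans _ _ (C * L * sdist Sl y)).
    have Ld : 0 <= L * sdist Sl y by rewrite mulr_ge0// ltW.
    rewrite -mulrDl -mulrA ler_wpM2r//; lra.
  by rewrite ler_wpM2l// mulr_ge0// ltW.
- move=> y Oy; apply: (le_trans (lerD (grad_le _ _ _ g1L Oy) (grad_le _ _ _ g2L Oy))).
  by rewrite !mulrA -mulrDl ler_wpM2r//; lra.
(* The second derivatives exist and are bounded at every point off the slit. *)
- apply: ae_in_everywhere => y Oy.
  have [h1 e1] := hess_le _ idx_n1 _ g1L Oy; have [h2 e2] := hess_le _ idx_n _ g2L Oy.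
  split => //; apply: (le_trans (lerD e1 e2)).
  have d0 := dpos _ Oy; have dd := dist_le_sdist S0 y (ltn0Sn _).
  have D0 : 0 < dist y Sl := lt_le_trans d0 (sdist_le_dist S0 y).
  have Y0 : 0 <= L / dist y Sl by rewrite divr_ge0// ltW.
  have X : L / sdist Sl y <= nR * (L / dist y Sl).
    by rewrite mulrCA ler_wpM2l// ler_pdivlMr// mulrC ler_pdivrMr.
  exact: hess_arith.
Qed.
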